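(* Let $[C=C_1\cup C_2,\ \omega_C\otimes A]$ be a general Prym-canonical binary curve of genus $g$ with $3\le g\le 12$. Then the first Gaussian map $$\mu_A:\Lambda^2H^0(C,\omega_C\otimes A)\to H^0(C,\omega_C^{\otimes 2}\otimes\Omega^1_C)$$ is injective.
   Context: Work over $\mathbb C$. A (stable) binary curve of genus $g$ is a nodal curve $C=C_1\cup C_2$ that is the union of two smooth rational curves meeting transversally at $g+1$ distinct points. Prym-canonical binary curves. Put $k=\lfloor g/2\rfloor$ and choose parameters $a_{i,j}\in\mathbb C$, $1\le i\le g-1$, $j=1,2$, such that for each $j$ the $a_{i,j}$ are nonzero and pairwise distinct. Put $M_j(t,u)=\prod_{r=1}^{g-1}(t-a_{r,j}u)$, $A_j=\prod_{i=1}^{g-1}a_{i,j}$, let $d_2$ be a nonzero constant and $d_1=-d_2A_1/A_2$. Define $\phi_j:\mathbb P^1\to\mathbb P^{g-2}$, $j=1,2$, by letting the $i$-th homogeneous coordinate of $\phi_j(t,u)$ be $$\frac{t\,M_j(t,u)}{t-a_{i,j}u}\ \ (1\le i\le k),\qquad \frac{-M_j(t,u)\,d_j\,a_{i,j}\,u}{A_j\,(t-a_{i,j}u)}\ \ (k+1\le i\le g-1).$$ Then for both $j=1,2$: $\phi_j([a_{l,j},1])=P_l$, the $l$-th coordinate point of $\mathbb P^{g-2}$, for $1\le l\le g-1$; $\phi_j([0,1])=P_g=[0,\dots,0,1,\dots,1]$ (first $k$ coordinates $0$, the remaining ones $1$); $\phi_j([1,0])=P_{g+1}=[1,\dots,1,0,\dots,0]$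 (first $k$ coordinates $1$, the remaining ones $0$). Gluing the two copies of $\mathbb P^1$ at these $g+1$ pairs of points gives a binary curve $C=C_1\cup C_2$ of genus $g$ with nodes corresponding to $P_1,\dots,P_{g+1}$, and, for a general choice of the $a_{i,j}$, the maps $\phi_1,\phi_2$ glue to the map $C\to\mathbb P^{g-2}$ given by the complete linear system $|\omega_C\otimes A|$, where $\omega_C$ is the dualizing sheaf and $A$ is a nontrivial line bundle with $A^{\otimes 2}\cong\mathcal O_C$ (for $g\ge 5$ one regards $C$ as embedded in $\mathbb P^{g-2}$ by this map). Explicitly, under the identification of $\mathrm{Pic}^0(C)$ (line bundles trivial on each component) with $(\mathbb C^* )^{g+1}/\mathbb C^*$ given by the gluing data at the nodes $P_1,\dots,P_{g+1}$, $A$ is the class of $(h_1,\dots,h_{g+1})$ with $h_i=1$ for $1\le i\le k$, $h_i=-1$ for $k+1\le i\le g-1$, $h_g=-1$, $h_{g+1}=1$. Such a pair $[C,A]$ is called a Prym-canonical binary curve; ''general'' means for all parameters $(a_{i,j})$ in a nonempty Zariski open subset of $\mathbb C^{2(g-1)}$. Gaussian map. $\Omega^1_C$ is the sheaf of Kähler differentials of $C$ (it has torsion at the nodes). If $\sigma_i=f_i\,\xi\otimes l$, $i=1,2$, are local expressions of two sections of $\omega_C\otimes A$, with $\xi$, $l$ local generators of $\omega_C$ and $A$, then $$\mu_A(\sigma_1\wedge\sigma_2)=(f_1\,df_2-f_2\,df_1)\,\xi^2\otimes l^2,$$ a section of $(\omega_C\otimes A)^{\otimes 2}\otimes\Omega^1_C\cong\omega_C^{\otimes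 2}\otimes\Omega^1_C$. *)

(* Defs.v *)
From HB Require Import structures.
From mathcomp Require Import all_boot all_order all_algebra.
From mathcomp Require Import boolp reals complex.
From mathcomp Require Import zify.
From mathcomp Require Import generic_quotient ring_quotient freeg mpoly.

Set Implicit Arguments.
Unset Strict Implicit.
Unset Printing Implicit Defensive.

Import GRing.Theory.
Local Open Scope ring_scope.
Local Open Scope quotient_scope.

Section Presented.
Variables (K : fieldType) (X : choiceType) (rel : {freeg X / K} -> Prop).

Inductive relation_span : {freeg X / K} -> Prop :=
| relation_span0 : relation_span 0
| relation_spanP k u v : rel u -> relation_span v -> relation_span (k *: u + v).

Definition relation_pred := [pred u : {freeg X / K} | `[< relation_span u >]].

Lemma relation_submod_closed : submod_closed relation_pred.
Proof.
split=> [|k u v]; rewrite !inE; first by apply/asboolP; constructor.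
move=> /asboolP hu /asboolP hv; apply/asboolP.
elim: hu => [|l u' v' hu' _ IH]; first by rewrite scaler0 add0r.
by rewrite scalerDr -addrA scalerA; constructor.
Qed.

HB.instance Definition _ :=
  GRing.isSubmodClosed.Build K {freeg X / K} relation_pred relation_submod_closed.

Definition presented := Quotient.quot relation_pred.
HB.instance Definition _ := GRing.Zmodule.on presented.
HB.instance Definition _ := ZmodQuotient.on presented.

Definition gen (x : X) : presented := \pi_presented << x >>.

Definition presented_scale (k : K) (q : presented) : presented :=
  \pi_presented (k *: repr q).

Lemma presented_eq (u v : {freeg X / K}) :
  u - v \in relation_pred -> \pi_presented u = \pi_presented v.
Proof. by rewrite (Quotient.idealrBE relation_pred u v) => /eqP. Qed.

Lemma presented_repr (u : {freeg X / K}) :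
  repr (\pi_presented u) - u \in relation_pred.
Proof. by rewrite (Quotient.idealrBE relation_pred) reprK. Qed.

Lemma presented_scaleE k u :
  presented_scale k (\pi_presented u) = \pi_presented (k *: u).
Proof. by apply: presented_eq; rewrite -scalerBr; apply/rpredZ/presented_repr. Qed.

Fact presented_scaleA a b q :
  presented_scale a (presented_scale b q) = presented_scale (a * b) q.
Proof.
elim/quotW: q => u; rewrite [presented_scale b _]presented_scaleE.
by rewrite !presented_scaleE scalerA.
Qed.

Fact presented_scale1 : left_id 1 presented_scale.
Proof. by elim/quotW=> u; rewrite presented_scaleE scale1r. Qed.

Fact presented_scaleDr : right_distributive presented_scale +%R.
Proof.
move=> k; elim/quotW=> u; elim/quotW=> v.
by rewrite -raddfD !presented_scaleE -raddfD scalerDr.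
Qed.

Fact presented_scaleDl q : {morph presented_scale^~ q : a b / a + b}.
Proof.
by elim/quotW: q => u a b; rewrite !presented_scaleE scalerDl raddfD.
Qed.

HB.instance Definition _ := GRing.Zmodule_isLmodule.Build K presented
  presented_scaleA presented_scale1 presented_scaleDr presented_scaleDl.

Lemma presented_pi_linear : linear (\pi_presented : {freeg X / K} -> presented).
Proof.
by move=> k u v; rewrite raddfD; congr (_ + _); apply/esym/presented_scaleE.
Qed.

Lemma gen_lincomb k x y z :
  rel (<< x >> - (k *: << y >> + << z >>)) -> gen x = k *: gen y + gen z.
Proof.
move=> h; rewrite /gen -presented_pi_linear; apply: presented_eq.
by rewrite inE; apply/asboolP; rewrite -[_ - _]addr0 -[_ - _]scale1r; do 2?constructor.
Qed.

Section Lift.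
Variables (M : lmodType K) (f : X -> M).

Definition presented_lift (q : presented) : M := fglift f (repr q).

Lemma fgliftB u v : fglift f (u - v) = fglift f u - fglift f v.
Proof. exact: lift_is_additive. Qed.

Lemma fglift0 : fglift f 0 = 0.
Proof. by rewrite -[0](subrr 0) fgliftB subrr. Qed.

Lemma fgliftD u v : fglift f (u + v) = fglift f u + fglift f v.
Proof. by rewrite -{1}[v]opprK fgliftB -[- v]sub0r fgliftB fglift0 sub0r opprK. Qed.

Lemma fglift_linear : linear (fglift f).
Proof.
move=> k u v; rewrite fgliftD; congr (_ + _).
elim/freeg_ind_dom0: u => [|l x u _ _ IH]; first by rewrite !(scaler0, fglift0).
rewrite scalerDr !fgliftD IH scalerDr; congr (_ + _).
have -> : k *: << l *g x >> = << k * l *g x >> :> {freeg X / K}.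
  by apply/eqP/freeg_eqP => y; rewrite coeffZ !coeffU mulrA.
by rewrite !liftU scalerA.
Qed.

Hypothesis f_rel : forall u, rel u -> fglift f u = 0.

Lemma presented_lift_pi u : presented_lift (\pi_presented u) = fglift f u.
Proof.
apply/eqP; rewrite -subr_eq0 -fgliftB; apply/eqP.
have /asboolP := presented_repr u; move: (_ - u) => z; elim=> [|k v w hv _ IH]; first exact: fglift0.
by rewrite fglift_linear (f_rel hv) scaler0 add0r.
Qed.

Lemma presented_lift_gen x : presented_lift (gen x) = f x.
Proof. by rewrite presented_lift_pi liftU scale1r. Qed.

Lemma presented_lift_linear : linear presented_lift.
Proof.
move=> k; elim/quotW=> u; elim/quotW=> v.
by rewrite -presented_pi_linear !presented_lift_pi fglift_linear.
Qed.

End Lift.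
End Presented.

Lemma linear_map0 (K : fieldType) (U V : lmodType K) (f : U -> V) :
  linear f -> f 0 = 0.
Proof.
by move/scalable_linear/(_ 0 0); rewrite scale0r => ->; rewrite /= scale0r.
Qed.

Section ExteriorSquare.
Variables (K : fieldType) (V : lmodType K).
Local Notation sym v w := (<< (v, w) >> : {freeg (V * V)%type / K}).

Variant wedge_rel : {freeg (V * V)%type / K} -> Prop :=
| wedge_linl k u v w :
    wedge_rel (sym (k *: u + v) w - (k *: sym u w + sym v w))
| wedge_linr k u v w :
    wedge_rel (sym w (k *: u + v) - (k *: sym w u + sym w v))
| wedge_alt v : wedge_rel (sym v v).

Definition wedge2 := presented wedge_rel.
HB.instance Definition _ := GRing.Lmodule.on wedge2.

Definition wedge (v w : V) : wedge2 := gen wedge_rel (v, w).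

Lemma wedge2_ind (P : wedge2 -> Prop) :
  P 0 -> (forall k v1 v2 w, P w -> P (k *: wedge v1 v2 + w)) -> forall w, P w.
Proof.
move=> P0 PS; elim/quotW=> u.
elim/freeg_ind_dom0: u => [|k [v1 v2] u _ _ Pu]; first by rewrite raddf0.
have -> : << k *g (v1, v2) >> = k *: sym v1 v2.
  by apply/eqP/freeg_eqP => y; rewrite coeffZ !coeffU mul1r.
by rewrite (presented_pi_linear wedge_rel k (sym v1 v2) u); apply: PS.
Qed.

Section WedgeLift.
Variables (M : lmodType K) (f : V -> V -> M).
Hypothesis f_linl : forall w, linear (f^~ w).
Hypothesis f_linr : forall v, linear (f v).
Hypothesis f_alt : forall v, f v v = 0.

Lemma wedge_rel_lift u : wedge_rel u -> fglift (fun vw => f vw.1 vw.2) u = 0.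
Proof.
case=> [k {}u v w|k {}u v w|v]; last by rewrite liftU scale1r f_alt.
- by rewrite fgliftB fglift_linear !liftU !scale1r /= f_linl subrr.
- by rewrite fgliftB fglift_linear !liftU !scale1r /= f_linr subrr.
Qed.
End WedgeLift.

End ExteriorSquare.

Section Kahler.
Variables (K : fieldType) (B : comAlgType K).
Local Notation sym b c := (<< (b, c) >> : {freeg (B * B)%type / K}).

Variant kahler_rel : {freeg (B * B)%type / K} -> Prop :=
| kahler_linl k a b c :
    kahler_rel (sym (k *: a + b) c - (k *: sym a c + sym b c))
| kahler_linr k b c e :
    kahler_rel (sym b (k *: c + e) - (k *: sym b c + sym b e))
| kahler_leibniz b c e :
    kahler_rel (sym b (c * e) - (sym (b * c) e + sym (b * e) c)).

Definition kahler := presented kahler_rel.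
HB.instance Definition _ := GRing.Lmodule.on kahler.

Definition bd (b c : B) : kahler := gen kahler_rel (b, c).

Lemma bd_linl c : linear (bd^~ c).
Proof. by move=> k a b; apply/gen_lincomb/kahler_linl. Qed.

Lemma bd_linr b : linear (bd b).
Proof. by move=> k c e; apply/gen_lincomb/kahler_linr. Qed.

Lemma bd_leibniz b c e : bd b (c * e) = bd (b * c) e + bd (b * e) c.
Proof.
rewrite -[bd (b * c) e]scale1r; apply: gen_lincomb.
by rewrite scale1r; apply: kahler_leibniz.
Qed.

(** The [B]-module structure of [kahler]. *)
Definition kahler_scale (a : B) : kahler -> kahler :=
  presented_lift (fun bc => bd (a * bc.1) bc.2).

Lemma kahler_scale_rel a u : kahler_rel u -> fglift (fun bc => bd (a * bc.1) bc.2) u = 0.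
Proof.
case=> [k {}u v c|k b c e|b c e]; rewrite fgliftB.
- by rewrite fglift_linear !liftU !scale1r /= mulrDr -scalerAr bd_linl subrr.
- by rewrite fglift_linear !liftU !scale1r /= bd_linr subrr.
- by rewrite fgliftD !liftU !scale1r /= bd_leibniz !mulrA subrr.
Qed.

Lemma kahler_scale_bd a b c : kahler_scale a (bd b c) = bd (a * b) c.
Proof. by apply: presented_lift_gen => u /kahler_scale_rel. Qed.

Lemma kahler_scale_linear a : linear (kahler_scale a).
Proof. by apply: presented_lift_linear => u /kahler_scale_rel. Qed.

End Kahler.

(** A field of fractions of [{poly K}]. The library's [{fraction {poly K}}] is
    one, but it is not used directly because failing unifications unfold it and
    do not terminate in practice. *)
Record function_field (K : fieldType) := FunctionField {
  function_field_sort : fieldType;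
  of_poly : {rmorphism {poly K} -> function_field_sort};
  of_poly_inj : injective of_poly;
  of_poly_frac : forall f, exists P Q, Q != 0 /\ f = of_poly P / of_poly Q }.

Fact function_field_exists (K : fieldType) : function_field K.
Proof.
pose iota : {rmorphism {poly K} -> {fraction {poly K}}} := @tofrac {poly K}.
apply: (@FunctionField K _ iota) => [P Q /eqP|].
  by rewrite tofrac_eq => /eqP.
elim/quotW => x; exists (frac x).1, (frac x).2; split; first exact: denom_ratioP.
rewrite /iota /=; unlock FracField.tofrac.
have e : ((\pi_(FracField.type {poly K}) (Ratio (frac x).2 1))^-1 = \pi_(FracField.type {poly K}) (FracField.invf (Ratio (frac x).2 1)))%qT.
  by rewrite FracField.pi_inv.
rewrite e -[RHS]FracField.pi_mul; apply/eqmodP => /=.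
rewrite /FracField.mulf /FracField.invf /= FracField.equivfE !numden_Ratio ?oner_eq0 ?mulf_neq0 ?oner_eq0 ?denom_ratioP //.
  by rewrite mul1r mulr1 mulrC.
Qed.

Definition ratfun (K : fieldType) : Type :=
  function_field_sort (function_field_exists K).

Section RatFun.
Variable K : fieldType.
HB.instance Definition _ := GRing.Field.on (ratfun K).

Definition poly_ratfun : {rmorphism {poly K} -> ratfun K} :=
  of_poly (function_field_exists K).

Lemma poly_ratfun_inj : injective poly_ratfun.
Proof. exact: of_poly_inj. Qed.

Lemma poly_ratfun_frac (f : ratfun K) :
  exists P Q, Q != 0 /\ f = poly_ratfun P / poly_ratfun Q.
Proof. exact: of_poly_frac. Qed.

Lemma poly_ratfun_eq0 P : (poly_ratfun P == 0) = (P == 0).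
Proof. exact: (raddf_eq0 _ poly_ratfun_inj). Qed.

Definition ratfun_const (k : K) : ratfun K := poly_ratfun k%:P.
Definition ratfun_scale (k : K) (f : ratfun K) : ratfun K := ratfun_const k * f.

Fact ratfun_scaleA a b f :
  ratfun_scale a (ratfun_scale b f) = ratfun_scale (a * b) f.
Proof. by rewrite /ratfun_scale mulrA /ratfun_const !rmorphM. Qed.
Fact ratfun_scale1 : left_id 1 ratfun_scale.
Proof. by move=> f; rewrite /ratfun_scale /ratfun_const !rmorph1 mul1r. Qed.
Fact ratfun_scaleDr : right_distributive ratfun_scale +%R.
Proof. by move=> k f f'; apply: mulrDr. Qed.
Fact ratfun_scaleDl f : {morph ratfun_scale^~ f : a b / a + b}.
Proof. by move=> a b; rewrite /ratfun_scale /ratfun_const !rmorphD mulrDl. Qed.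
HB.instance Definition _ := GRing.Zmodule_isLmodule.Build K (ratfun K)
  ratfun_scaleA ratfun_scale1 ratfun_scaleDr ratfun_scaleDl.
Fact ratfun_scaleAl k (f f' : ratfun K) : k *: (f * f') = k *: f * f'.
Proof. exact: mulrA. Qed.
HB.instance Definition _ :=
  GRing.Lmodule_isLalgebra.Build K (ratfun K) ratfun_scaleAl.
Fact ratfun_scaleAr k (f f' : ratfun K) : k *: (f * f') = f * (k *: f').
Proof. exact: mulrCA. Qed.
HB.instance Definition _ :=
  GRing.Lalgebra_isAlgebra.Build K (ratfun K) ratfun_scaleAr.

Definition ratfun_t : ratfun K := poly_ratfun 'X.
End RatFun.
Arguments poly_ratfun {K}.

(** [Some c] is the point [[c,1]] and [None] is the point [[1,0]]. *)
Definition P1 (K : fieldType) := option K.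

Section P1.
Variable K : fieldType.
Implicit Types (p : P1 K) (f s : ratfun K).
Local Notation t := (ratfun_t K).

Definition unif p : ratfun K :=
  if p is Some c then t - c%:A else t^-1.

(** The derivative of [unif p] with respect to [t]. *)
Definition dunif p : ratfun K :=
  if p is Some _ then 1 else - (t ^- 2).

(** [f] is regular at [p] and takes the value [v] there: since
    [K(t) = K(unif p)], the local ring at [p] consists of the fractions
    [P(unif p) / Q(unif p)] with [Q(0) <> 0]. *)
Definition has_value p f (v : K) := exists P Q : {poly K},
  [/\ Q.[0] != 0, f * horner_alg (unif p) Q = horner_alg (unif p) P
    & v = P.[0] / Q.[0]].

Definition regular p f := exists v, has_value p f v.

(** A rational differential form on the projective line is written [s dt], and
    is identified with the rational function [s]. *)
Definition regular_form p s := regular p (s / dunif p).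

(** [s dt] has at most a simple pole at [p], with residue [r]. *)
Definition has_residue p s (r : K) := has_value p (s / dunif p * unif p) r.

Lemma has_valueD p f f' v v' :
  has_value p f v -> has_value p f' v' -> has_value p (f + f') (v + v').
Proof.
move=> [P [Q [hQ hf ->]]] [P' [Q' [hQ' hf' ->]]].
exists (P * Q' + P' * Q), (Q * Q'); split.
- by rewrite hornerM mulf_neq0.
- rewrite !(rmorphD, rmorphM) /= -hf -hf' mulrDl !mulrA; congr (_ + _).
  by rewrite mulrAC.
- by rewrite hornerD !hornerM addf_div.
Qed.

Lemma has_valueM p f f' v v' :
  has_value p f v -> has_value p f' v' -> has_value p (f * f') (v * v').
Proof.
move=> [P [Q [hQ hf ->]]] [P' [Q' [hQ' hf' ->]]].
exists (P * P'), (Q * Q'); split.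
- by rewrite hornerM mulf_neq0.
- by rewrite !rmorphM /= -hf -hf' mulrACA.
- by rewrite !hornerM mulf_div.
Qed.

Lemma has_valueC p k : has_value p k%:A k.
Proof.
exists k%:P, 1; split; first by rewrite hornerC oner_neq0.
- by rewrite rmorph1 mulr1 [RHS]horner_algC.
- by rewrite !hornerC divr1.
Qed.

Lemma has_valueZ p k f v : has_value p f v -> has_value p (k *: f) (k * v).
Proof. by rewrite -mulr_algl; apply: has_valueM; apply: has_valueC. Qed.

Lemma has_valueN p f v : has_value p f v -> has_value p (- f) (- v).
Proof. by rewrite -scaleN1r -[- v]mulN1r; apply: has_valueZ. Qed.

Lemma has_value0 p : has_value p 0 0.
Proof. by rewrite -(scale0r 1); apply: has_valueC. Qed.

Lemma has_value1 p : has_value p 1 1.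
Proof. by rewrite -{1}[1]scale1r; apply: has_valueC. Qed.

Lemma has_value_lin p k f f' v v' :
  has_value p f v -> has_value p f' v' ->
  has_value p (k *: f + f') (k * v + v').
Proof. by move=> /(@has_valueZ _ k); apply: has_valueD. Qed.

Lemma ratfun_t_neq0 : t != 0.
Proof. by rewrite poly_ratfun_eq0 polyX_eq0. Qed.

Lemma ratfun_tB_neq0 c : t - c%:A != 0.
Proof.
have -> : t - c%:A = poly_ratfun ('X - c%:P) :> ratfun K.
  by rewrite rmorphB; congr (_ - _); apply: mulr1.
by rewrite poly_ratfun_eq0 polyXsubC_eq0.
Qed.

Lemma unif_neq0 p : unif p != 0.
Proof.
case: p => [c|]; first exact: ratfun_tB_neq0.
by rewrite invr_eq0 ratfun_t_neq0.
Qed.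

Lemma dunif_neq0 p : dunif p != 0.
Proof.
case: p => [c|] /=; first exact: oner_neq0.
by rewrite oppr_eq0 invr_eq0 expf_neq0 // ratfun_t_neq0.
Qed.

(** The coordinate [unif p] and the form [d(unif p)] have no zero or pole outside
    [p] and [opposite p]. *)
Definition opposite p : P1 K := if p is Some _ then None else Some 0.

Lemma opposite_neq p : p != opposite p.
Proof. by case: p. Qed.

Definition unit_at p f := exists v, [/\ f != 0, v != 0 & has_value p f v].

Lemma unit_atC p k : k != 0 -> unit_at p k%:A.
Proof.
move=> k0; exists k; split=> //; last exact: has_valueC.
by rewrite scaler_eq0 (negbTE k0) oner_eq0.
Qed.

Lemma unit_at1 p : unit_at p 1.
Proof. by rewrite -[1]scale1r; apply/unit_atC/oner_neq0. Qed.

Lemma unit_atM p f f' : unit_at p f -> unit_at p f' -> unit_at p (f * f').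
Proof.
move=> [v [f0 v0 hv]] [v' [f0' v0' hv']]; exists (v * v').
by split; [apply: mulf_neq0|apply: mulf_neq0|apply: has_valueM].
Qed.

Lemma unit_atV p f : unit_at p f -> unit_at p f^-1.
Proof.
move=> [v [f0 v0 [P [Q [hQ hf hv]]]]]; exists v^-1.
split; rewrite ?invr_eq0 //; exists Q, P; split.
- by apply: contraNneq v0; rewrite hv => ->; rewrite mul0r.
- by rewrite -hf mulKf.
- by rewrite hv invf_div.
Qed.

Lemma unit_atN p f : unit_at p f -> unit_at p (- f).
Proof.
rewrite -mulN1r -[-1]scale1r scalerN -scaleNr => h; apply: unit_atM => //.
by apply: unit_atC; rewrite oppr_eq0 oner_eq0.
Qed.

Lemma unit_at_unif p q : q <> p -> q <> opposite p -> unit_at q (unif p).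
Proof.
have ht c d : d != c -> unit_at (Some d) (t - c%:A).
  move=> dc; exists (d - c); split; first exact: ratfun_tB_neq0.
    by rewrite subr_eq0.
  exists ('X + (d - c)%:P), 1; split; first by rewrite hornerC oner_neq0.
    rewrite rmorph1 mulr1 rmorphD /= horner_algX horner_algC /=.
    by rewrite scalerBl addrA subrK.
  by rewrite hornerE hornerX add0r !hornerC divr1.
case: p q => [c|] [d|] //= hp hq; first by apply: ht; apply/eqP => e; rewrite e in hp.
apply: unit_atV; rewrite -[t]subr0 -[0](scale0r 1); apply: ht.
by apply/eqP => e; rewrite e in hq.
Qed.

Lemma unit_at_dunif p q : q <> opposite p -> unit_at q (dunif p / dunif q).
Proof.
case: p q => [c|] [d|] //= hq.
- by rewrite divr1; apply: unit_at1.
- rewrite divr1; apply: unit_atN; rewrite -exprVn expr2.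
  by apply: unit_atM; apply: (@unit_at_unif None).
- by rewrite mulfV ?(dunif_neq0 None) //; apply: unit_at1.
Qed.
End P1.

(** The nodal curve obtained from two copies of the projective line, indexed by
    ['I_2], by identifying [node ord0 i] with [node ord_max i] for each [i]. *)
Record binary_curve (K : fieldType) (g : nat) := BinaryCurve {
  node :> 'I_2 -> 'I_g.+1 -> P1 K;
  node_inj : forall j, injective (node j) }.

Section BinaryCurve.
Variables (K : fieldType) (g : nat) (C : binary_curve K g).

(** Rational functions on [C]; they also stand for the rational differentials
    [(s.1 dt, s.2 dt)]. *)
Local Notation F := (ratfun K * ratfun K)%type.

Definition component (j : 'I_2) (s : F) := if j == ord0 then s.1 else s.2.

Variant point :=
| Smooth j p of forall i, p <> C j i
| Node of 'I_g.+1.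

(** The total ring of fractions of the local ring of [C] at [x]: near a smooth
    point only one of the components is visible. *)
Definition ambient (x : point) : comUnitAlgType K :=
  match x with Smooth _ _ _ => ratfun K | Node _ => F end.

Definition germ (x : point) : F -> ambient x :=
  match x with Smooth j _ _ => component j | Node _ => id end.

Definition local_ring (x : point) : ambient x -> Prop :=
  match x with
  | Smooth _ p _ => regular p
  | Node i => fun f => exists v,
      has_value (C ord0 i) f.1 v /\ has_value (C ord_max i) f.2 v
  end.

(** The dualizing sheaf: forms which are regular at the smooth points and have
    at most simple poles, with opposite residues, at the nodes. *)
Definition dualizing (x : point) : ambient x -> Prop :=
  match x with
  | Smooth _ p _ => regular_form p
  | Node i => fun s => exists r,
      has_residue (C ord0 i) s.1 r /\ has_residue (C ord_max i) s.2 (- r)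
  end.

Record gluing := Gluing {
  glue :> 'I_g.+1 -> K;
  glue_neq0 : forall i, glue i != 0 }.

(** The line bundle, trivial on each component, with gluing data [h]. *)
Definition glued_bundle (h : gluing) (x : point) : ambient x -> Prop :=
  match x with
  | Smooth _ p _ => regular p
  | Node i => fun l => exists v,
      has_value (C ord0 i) l.1 v /\ has_value (C ord_max i) l.2 (h i * v)
  end.

Section LocalRing.
Variable x : point.

Definition local_pred : {pred ambient x} := fun f => `[< local_ring f >].

Lemma local_subalg_closed : subalg_closed local_pred.
Proof.
rewrite /local_pred; case: x => [j p hp|i]; split=> [|k f f'|f f'];
  rewrite /in_mem /=.
- by apply/asboolP; exists 1; apply: has_value1.
- move=> /asboolP[v hv] /asboolP[v' hv']; apply/asboolP.
  by exists (k * v + v'); apply: has_value_lin.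
- move=> /asboolP[v hv] /asboolP[v' hv']; apply/asboolP.
  by exists (v * v'); apply: has_valueM.
- by apply/asboolP; exists 1; split; apply: has_value1.
- move=> /asboolP[v [hv1 hv2]] /asboolP[v' [hv1' hv2']]; apply/asboolP.
  by exists (k * v + v'); split; apply: has_value_lin.
- move=> /asboolP[v [hv1 hv2]] /asboolP[v' [hv1' hv2']]; apply/asboolP.
  by exists (v * v'); split; apply: has_valueM.
Qed.

HB.instance Definition _ :=
  GRing.isSubalgClosed.Build K (ambient x) local_pred local_subalg_closed.

Record stalk := Stalk { stalk_val :> ambient x; _ : stalk_val \in local_pred }.

HB.instance Definition _ := [isSub for stalk_val].
HB.instance Definition _ := [Choice of stalk by <:].
HB.instance Definition _ := [SubChoice_isSubAlgebra of stalk by <:].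
Fact stalk_mulC : commutative (@GRing.mul stalk).
Proof. by move=> a b; apply: val_inj; rewrite !rmorphM mulrC. Qed.
HB.instance Definition _ :=
  GRing.PzSemiRing_hasCommutativeMul.Build stalk stalk_mulC.
End LocalRing.


Definition ideal_prod (A : nzRingType) (I J : A -> Prop) (m : A) : Prop :=
  exists2 r : seq (A * A), (forall u, u \in r -> I u.1 /\ J u.2)
    & m = \sum_(u <- r) u.1 * u.2.

Section Twisted.
Variable h : gluing.

(** The tensor product of the dualizing sheaf and of the line bundle: both are
    invertible, and tensor products of invertible submodules of the total ring
    of fractions are their products. *)
Definition twisted_dualizing (x : point) : ambient x -> Prop :=
  ideal_prod (@dualizing x) (@glued_bundle h x).

Definition section_pred : {pred F} :=
  fun s => `[< forall x, twisted_dualizing (germ x s) >].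

Fact germ_linear x : linear (germ x).
Proof. by case: x => [j p hp|i] k u v //=; rewrite /component; case: ifP. Qed.

Fact germ0 x : germ x 0 = 0.
Proof. by case: x => [j p hp|i] //=; rewrite /component; case: ifP. Qed.

Fact dualizingZ x k s : @dualizing x s -> @dualizing x (k *: s).
Proof.
case: x s => [j p hp|i] s /=.
  by move=> [v hv]; exists (k * v); rewrite /= -scalerAl; apply: has_valueZ.
move=> [r [h1 h2]]; exists (k * r).
by rewrite /has_residue -mulrN /= -!scalerAl; split; apply: has_valueZ.
Qed.

Fact section_submod_closed : submod_closed section_pred.
Proof.
split=> [|k u v]; rewrite /in_mem /=.
  apply/asboolP => x; exists [::] => //.
  by rewrite big_nil germ0.
move=> /asboolP hu /asboolP hv; apply/asboolP => x.
have [ru hru eu] := hu x; have [rv hrv ev] := hv x.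
exists ([seq (k *: w.1, w.2) | w <- ru] ++ rv).
  move=> w; rewrite mem_cat => /orP[/mapP[w' /hru[h1 h2] ->]|/hrv //].
  by split=> //; apply: dualizingZ.
rewrite germ_linear big_cat big_map eu ev scaler_sumr; congr (_ + _).
by apply: eq_bigr => w _ /=; rewrite scalerAl.
Qed.

HB.instance Definition _ :=
  GRing.isSubmodClosed.Build K F section_pred section_submod_closed.

(** The space of global sections of the twisted dualizing sheaf. *)
Record sections := Sections { section_val :> F; _ : section_val \in section_pred }.

HB.instance Definition _ := [isSub for section_val].
HB.instance Definition _ := [Choice of sections by <:].
HB.instance Definition _ := [SubChoice_isSubLmodule of sections by <:].

(** [e] is a free generator of the [O_(C,x)]-submodule [M]. *)
Definition local_generator x (M : ambient x -> Prop) (e : ambient x) : Prop :=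
  e \is a GRing.unit /\ forall m, M m <-> exists f : stalk x, m = val f * e.

(** A local generator [xi] of the dualizing sheaf, and [ell] of the line
    bundle. *)
Record frame (x : point) := Frame {
  frame_xi : ambient x;
  frame_ell : ambient x;
  _ : local_generator (@dualizing x) frame_xi;
  _ : local_generator (@glued_bundle h x) frame_ell }.

(** The germ [f] such that [s = f * xi * ell] near [x]. *)
Definition coordinate x (e : frame x) (s : sections) : stalk x :=
  insubd 0 (germ x s / (frame_xi e * frame_ell e)).

Lemma frame_unit x (e : frame x) : frame_xi e * frame_ell e \is a GRing.unit.
Proof. by case: e => xi ell h1 h2; rewrite unitrM h1.1 h2.1. Qed.

Lemma coordinateE x (e : frame x) (s : sections) :
  germ x s = val (coordinate e s) * (frame_xi e * frame_ell e).
Proof.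
case: e => xi ell hxi hell; rewrite /coordinate /=.
have hu : xi * ell \is a GRing.unit by rewrite unitrM hxi.1 hell.1.
suff [f ->] : exists f : stalk x, germ x s = val f * (xi * ell).
  by rewrite mulrK // insubdK ?(valP f) // valKd.
case: s => s /= /asboolP/(_ x)[r hr ->] {s}.
elim: r hr => [|w r IH] hr; first by exists 0; rewrite big_nil mul0r.
have [f IHf] : exists f : stalk x, \sum_(u <- r) u.1 * u.2 = val f * (xi * ell).
  by apply: IH => u ur; apply: hr; rewrite inE ur orbT.
have [] := hr w (mem_head _ _).
move=> /hxi.2[f1 e1] /hell.2[f2 e2]; exists (f1 * f2 + f).
have -> : val (f1 * f2 + f) = val f1 * val f2 + val f by [].
by rewrite big_cons IHf e1 e2 mulrDl mulrACA.
Qed.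

Lemma coordinate_linear x (e : frame x) : linear (coordinate e).
Proof.
move=> k s s'; apply: val_inj.
apply: (mulIr (frame_unit e)); rewrite -coordinateE.
have -> : val (k *: coordinate e s + coordinate e s') =
  k *: val (coordinate e s) + val (coordinate e s') by [].
by rewrite mulrDl -scalerAl -!coordinateE -germ_linear.
Qed.

Definition avoids (Z : seq ('I_2 * P1 K)) (x : point) : Prop :=
  match x with
  | Smooth j p _ => (j, p) \notin Z
  | Node i => (ord0, C ord0 i) \notin Z /\ (ord_max, C ord_max i) \notin Z
  end.

Lemma smooth_dualizing_generator j p hp (e : ratfun K) :
  unit_at p (e / dunif p) -> local_generator (@dualizing (@Smooth j p hp)) e.
Proof.
move=> he; have e0 : e != 0.
  by case: he => v [] + _ _; apply: contraNneq => ->; rewrite mul0r.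
split; first by rewrite unitfE.
move=> m; split=> [[v hv]|[f ->]].
  have [w [_ _ hw]] := unit_atV he.
  have hf : regular p (m / e).
    exists (v * w); have -> : m / e = m / dunif p * (e / dunif p)^-1.
      by rewrite invf_div mulrA divfK ?dunif_neq0.
    exact: has_valueM.
  by exists (@Stalk (@Smooth j p hp) (m / e) (asboolT hf)); rewrite /= divfK.
have /asboolP[v hv] := valP f; have [w [_ _ hw]] := he.
by exists (v * w); rewrite /= -mulrA; apply: has_valueM.
Qed.

Lemma smooth_bundle_generator j p hp (e : ratfun K) :
  unit_at p e -> local_generator (@glued_bundle h (@Smooth j p hp)) e.
Proof.
move=> he; have e0 : e != 0 by case: he => v [].
split; first by rewrite unitfE.
move=> m; split=> [[v hv]|[f ->]].
  have [w [_ _ hw]] := unit_atV he.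
  have hf : regular p (m / e) by exists (v * w); apply: has_valueM.
  by exists (@Stalk (@Smooth j p hp) (m / e) (asboolT hf)); rewrite /= divfK.
have /asboolP[v hv] := valP f; have [w [_ _ hw]] := he.
by exists (v * w); apply: has_valueM.
Qed.

Definition log_form (p : P1 K) : ratfun K := dunif p / unif p.

Lemma log_form_neq0 p : log_form p != 0.
Proof. by rewrite mulf_neq0 ?invr_eq0 ?unif_neq0 ?dunif_neq0. Qed.

Lemma log_form_residue p f r :
  has_value p f r <-> has_residue p (f * log_form p) r.
Proof.
rewrite /has_residue; suff -> : f * log_form p / dunif p * unif p = f by [].
rewrite /log_form mulrA [_ / _ / _]mulrAC mulfK ?dunif_neq0 //.
by rewrite divfK ?unif_neq0.
Qed.

Lemma unit_pair (f f' : ratfun K) :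
  f != 0 -> f' != 0 -> (f, f') \is a @GRing.unit F.
Proof. by move=> f0 f0'; apply/andP; split; rewrite unitfE. Qed.

Lemma node_dualizing_generator i :
  local_generator (@dualizing (Node i))
    (log_form (C ord0 i), - log_form (C ord_max i)).
Proof.
set p := C ord0 i; set q := C ord_max i.
have hp := log_form_neq0 p; have hq := log_form_neq0 q.
split; first by apply: unit_pair; rewrite ?oppr_eq0.
move=> [m1 m2]; split=> [[r [/= h1 h2]]|[f ->]].
  have hf : @local_ring (Node i) (m1 / log_form p, - (m2 / log_form q)).
    exists r; split=> /=; first by apply/log_form_residue; rewrite divfK.
    by rewrite -[r]opprK; apply/has_valueN/log_form_residue; rewrite divfK.
  exists (@Stalk (Node i) _ (asboolT hf)).
  by congr pair; rewrite /= ?mulrNN divfK.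
have /asboolP[v [h1 h2]] := valP f; exists v.
have e2 : (val f * (log_form p, - log_form q) : F).2 =
    - (val f : F).2 * log_form q by rewrite mulNr -mulrN.
split; first exact: (iffLR (log_form_residue _ _ _) h1).
by rewrite e2; exact: (iffLR (log_form_residue _ _ _) (has_valueN h2)).
Qed.

Lemma node_bundle_generator i :
  local_generator (@glued_bundle h (Node i)) (1, (h i)%:A).
Proof.
have h0 := glue_neq0 h i.
have hA : (h i)%:A != 0 :> ratfun K by rewrite scaler_eq0 (negbTE h0) oner_eq0.
split; first by apply: unit_pair; rewrite ?oner_eq0.
move=> [m1 m2]; split=> [[v [/= h1 h2]]|[f ->]].
  have hf : @local_ring (Node i) (m1, (h i)^-1 *: m2).
    by exists v; split=> //=; rewrite -[v](mulKf h0); apply: has_valueZ.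
  exists (@Stalk (Node i) _ (asboolT hf)); congr pair; rewrite /= ?mulr1 //.
  by rewrite mulr_algr scalerA mulfV // scale1r.
have /asboolP[v [h1 h2]] := valP f; exists v; split=> /=; first by rewrite mulr1.
by rewrite mulr_algr; apply: has_valueZ.
Qed.

Lemma frame_near x : exists Z (xi ell : F), avoids Z x /\
  forall y, avoids Z y -> exists2 e : frame y,
    frame_xi e = germ y xi & frame_ell e = germ y ell.
Proof.
case: x => [j p hp|i].
  exists ((ord0, opposite p) :: (ord_max, opposite p) ::
    [seq (ord0, C ord0 k) | k <- enum 'I_g.+1]), (dunif p, dunif p), (1, 1).
  split.
    rewrite /= !inE !negb_or !xpair_eqE !negb_and !opposite_neq !orbT /=.
    by apply/mapP => -[k _ [ej ep]]; apply: (hp k); rewrite ej.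
  case=> [j' q hq|k] /=; last first.
    by case; rewrite !inE map_f ?mem_enum ?orbT.
  rewrite !inE !negb_or !xpair_eqE => /and3P[z1 z2 _].
  have hqo : q <> opposite p.
    move=> e; move: z1 z2; rewrite e eqxx !andbT.
    by case: j' {hq} => -[|[|//]] lj; rewrite -!val_eqE.
  have gen1 : local_generator (@dualizing (@Smooth j' q hq))
      (germ (@Smooth j' q hq) (dunif p, dunif p)).
    apply: smooth_dualizing_generator; rewrite /= /component /= if_same.
    exact: unit_at_dunif.
  have gen2 : local_generator (@glued_bundle h (@Smooth j' q hq))
      (germ (@Smooth j' q hq) (1, 1)).
    apply: smooth_bundle_generator; rewrite /= /component /= if_same.
    exact: unit_at1.
  by exists (Frame gen1 gen2).
set p0 := C ord0 i; set p1 := C ord_max i.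
exists ((ord0, opposite p0) :: (ord_max, opposite p1) ::
    [seq (ord0, C ord0 k) | k <- enum 'I_g.+1 & k != i]),
  (log_form p0, - log_form p1), (1, (h i)%:A).
split.
  rewrite /= !inE !negb_or !xpair_eqE !negb_and !opposite_neq !orbT /=.
  split; apply/mapP => -[k]; rewrite mem_filter => /andP[/eqP ki _] // [].
  by move=> /(@node_inj _ _ C ord0) /esym.
case=> [j q hq|k] /= hZ; last first.
  have -> : k = i.
    apply/eqP/negPn/negP => ki; case: hZ; rewrite !inE => /negP[].
    by rewrite map_f ?orbT // mem_filter ki mem_enum.
  by exists (Frame (node_dualizing_generator i) (node_bundle_generator i)).
have gen1 : local_generator (@dualizing (@Smooth j q hq))
    (germ (@Smooth j q hq) (log_form p0, - log_form p1)).
  have log_unit p : q <> p -> q <> opposite p -> unit_at q (log_form p / dunif q).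
    move=> qp qo; rewrite /log_form mulrAC; apply: unit_atM.
      exact: unit_at_dunif.
    exact/unit_atV/unit_at_unif.
  apply: smooth_dualizing_generator; rewrite /= /component /=.
  move: hZ; rewrite !inE !negb_or !xpair_eqE => /and3P[z1 z2 _].
  have [ej|ej] := eqVneq j ord0; first subst j.
    apply: log_unit; first by move=> e; apply: (hq i); rewrite e.
    by move=> e; move: z1; rewrite e !eqxx.
  have ej' : j = ord_max by apply/eqP; case: j ej {hq z1 z2} => -[|[|//]] lj.
  subst j; rewrite mulNr; apply/unit_atN/log_unit.
    by move=> e; apply: (hq i); rewrite e.
  by move=> e; move: z2; rewrite e !eqxx.
have gen2 : local_generator (@glued_bundle h (@Smooth j q hq))
    (germ (@Smooth j q hq) (1, (h i)%:A)).
  apply: smooth_bundle_generator; rewrite /= /component /=.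
  by case: ifP => _; [exact: unit_at1|apply/unit_atC/glue_neq0].
by exists (Frame gen1 gen2).
Qed.

(** A family of germs of sections of the tensor product of the square of the
    twisted dualizing sheaf with the sheaf of differentials: the germ at [x] is
    [s x e * (xi * ell)^2] for each local frame [e = (xi, ell)] at [x]. *)
Definition germ_family := forall x : point, frame x -> kahler (stalk x).

Definition frame_compatible (s : germ_family) :=
  forall x (e e' : frame x) (u : stalk x),
  frame_xi e' * frame_ell e' = val u * (frame_xi e * frame_ell e) ->
  s x e = kahler_scale (u ^+ 2) (s x e').

(** Near each point the germs are given by a single expression
    [(\sum_(b <- r) b.1 d b.2) * (xi * ell)^2]. *)
Definition locally_given (s : germ_family) := forall x,
  exists Z (xi ell : F) (r : seq (F * F)), avoids Z x /\
  forall y, avoids Z y -> exists (e : frame y) (r' : seq (stalk y * stalk y)),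
  [/\ frame_xi e = germ y xi, frame_ell e = germ y ell,
      [seq (val b.1, val b.2) | b <- r'] = [seq (germ y b.1, germ y b.2) | b <- r]
    & s y e = \sum_(b <- r') bd b.1 b.2].

Record differentials := Differentials {
  differentials_germ :> germ_family;
  _ : frame_compatible differentials_germ;
  _ : locally_given differentials_germ }.

(** The germ of the image of [s1 /\ s2], where [s1 = f1 * xi * ell] and
    [s2 = f2 * xi * ell]. *)
Definition gauss_form x (e : frame x) (s1 s2 : sections) : kahler (stalk x) :=
  let f1 := coordinate e s1 in let f2 := coordinate e s2 in
  bd f1 f2 - bd f2 f1.

Definition gauss_germ (w : wedge2 sections) : germ_family :=
  fun x e => presented_lift (fun s => gauss_form e s.1 s.2) w.

Lemma gauss_form_linl x (e : frame x) s2 : linear (fun s1 => gauss_form e s1 s2).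
Proof.
move=> k s s'; rewrite /gauss_form coordinate_linear bd_linl bd_linr.
by rewrite scalerBr opprD addrACA.
Qed.

Lemma gauss_form_linr x (e : frame x) s1 : linear (gauss_form e s1).
Proof.
move=> k s s'; rewrite /gauss_form coordinate_linear bd_linl bd_linr.
by rewrite scalerBr opprD addrACA.
Qed.

Lemma gauss_germ_wedge s1 s2 x (e : frame x) :
  gauss_germ (wedge s1 s2) e = gauss_form e s1 s2.
Proof.
apply: presented_lift_gen => u; apply: wedge_rel_lift => [v|v|v].
- exact: gauss_form_linl.
- exact: gauss_form_linr.
- exact: subrr.
Qed.

Lemma gauss_germ_linear x (e : frame x) : linear (fun w => gauss_germ w e).
Proof.
apply: presented_lift_linear => u; apply: wedge_rel_lift => [v|v|v].
- exact: gauss_form_linl.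
- exact: gauss_form_linr.
- exact: subrr.
Qed.

Lemma gauss_germ0 x (e : frame x) : gauss_germ 0 e = 0.
Proof. exact: (linear_map0 (gauss_germ_linear e)). Qed.

Lemma gauss_form_frame x (e e' : frame x) (u : stalk x) s1 s2 :
  frame_xi e' * frame_ell e' = val u * (frame_xi e * frame_ell e) ->
  gauss_form e s1 s2 = kahler_scale (u ^+ 2) (gauss_form e' s1 s2).
Proof.
move=> hu; have hf s : coordinate e s = u * coordinate e' s.
  apply/val_inj/(mulIr (frame_unit e)); rewrite -coordinateE (coordinateE e') hu.
  by rewrite mulrA [val _ * val u]mulrC.
rewrite /gauss_form !hf; set f1 := coordinate e' s1; set f2 := coordinate e' s2.
rewrite !bd_leibniz (additive_linear (kahler_scale_linear (u ^+ 2))).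
rewrite !kahler_scale_bd opprD addrACA.
have -> : u * f1 * f2 = u * f2 * f1 by rewrite mulrAC.
by rewrite subrr addr0 expr2 ![u * _ * u]mulrAC.
Qed.

Lemma gauss_germ_compatible w : frame_compatible (gauss_germ w).
Proof.
move=> x e e' u hu; elim/wedge2_ind: w => [|k s1 s2 w IH].
  by rewrite !gauss_germ0 (linear_map0 (kahler_scale_linear (u ^+ 2))).
rewrite !gauss_germ_linear kahler_scale_linear IH !gauss_germ_wedge.
by rewrite (gauss_form_frame _ _ hu).
Qed.

Lemma gauss_germ_local w : locally_given (gauss_germ w).
Proof.
move=> x; have [Z [xi [ell [hZ hfr]]]] := frame_near x.
suff [r hr] : exists r : seq (F * F), forall y (e : frame y),
    frame_xi e = germ y xi -> frame_ell e = germ y ell ->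
    exists r' : seq (stalk y * stalk y),
    [seq (val b.1, val b.2) | b <- r'] = [seq (germ y b.1, germ y b.2) | b <- r]
    /\ gauss_germ w e = \sum_(b <- r') bd b.1 b.2.
  exists Z, xi, ell, r; split=> // y /hfr[e exi eell]; exists e.
  by have [r' [h1 h2]] := hr y e exi eell; exists r'; split.
elim/wedge2_ind: w => [|k s1 s2 w [r IH]].
  by exists [::] => y e _ _; exists [::]; rewrite gauss_germ0 big_nil.
pose phi (s : sections) : F :=
  ((val s).1 / (xi.1 * ell.1), (val s).2 / (xi.2 * ell.2)).
exists [:: (k *: phi s1, phi s2), (- k *: phi s2, phi s1) & r] => y e exi eell.
have hphi s : val (coordinate e s) = germ y (phi s).
  apply: (mulIr (frame_unit e)); rewrite -coordinateE.
  have := frame_unit e; rewrite exi eell.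
  case: (y) => [j p hp|i] /=; rewrite /component.
    by case: ifP => _; rewrite unitfE => h0; rewrite divfK.
  case/andP; rewrite !unitfE /= => h1 h2.
  apply: etrans (surjective_pairing (val s)) _.
  exact: (f_equal2 pair (esym (divfK h1 _)) (esym (divfK h2 _))).
have [r' [h1 h2]] := IH y e exi eell.
exists [:: (k *: coordinate e s1, coordinate e s2),
  (- k *: coordinate e s2, coordinate e s1) & r'].
have hZ' l s : val (l *: coordinate e s) = germ y (l *: phi s).
  rewrite -[l *: phi s]addr0 germ_linear germ0 addr0 -hphi.
  by [].
split.
  rewrite !map_cons h1; congr [:: _, _ & _].
    exact: (f_equal2 pair (hZ' _ _) (hphi _)).
  exact: (f_equal2 pair (hZ' _ _) (hphi _)).
rewrite !big_cons /= gauss_germ_linear gauss_germ_wedge h2 addrA; congr (_ + _).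
have bdZ l b c : bd (l *: b) c = l *: bd b c :> kahler (stalk y).
  exact: (scalable_linear (bd_linl c)).
by rewrite !bdZ scalerBr scaleNr.
Qed.

Definition gauss_map (w : wedge2 sections) : differentials :=
  Differentials (@gauss_germ_compatible w) (@gauss_germ_local w).

End Twisted.
End BinaryCurve.

(** [prym_node a j i] is the preimage of the node [P_(i+1)] on the [j]-th
    component: [a_(i+1,j)] for [i < g - 1], then [[0,1]] for [i = g - 1] and
    [[1,0]] for [i = g]. The constants [d_1] and [d_2] only enter the map to
    projective space, not the curve nor the line bundle. *)
Section PrymCanonical.
Variables (K : fieldType) (g : nat).

Definition prym_parameters (a : 'M[K]_(g.-1, 2)) : Prop :=
  (forall i j, a i j != 0) /\ (forall j, injective (fun i => a i j)).

Definition prym_node (a : 'M[K]_(g.-1, 2)) (j : 'I_2) (i : 'I_g.+1) : P1 K :=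
  match @insub nat (fun m => m < g.-1)%N 'I_g.-1 i with
  | Some i' => Some (a i' j)
  | None => if i == g.-1 :> nat then Some 0 else None
  end.

Lemma prym_node_inj a : prym_parameters a -> forall j, injective (prym_node a j).
Proof.
move=> [a0 ainj] j i i'; rewrite /prym_node.
case: insubP => [k _ ki|ig]; case: insubP => [k' _ ki'|ig'].
- by case=> /ainj e; apply: ord_inj; rewrite -ki -ki' e.
- by case: ifP => // _ [] e; have := a0 k j; rewrite e eqxx.
- by case: ifP => // _ [] e; have := a0 k' j; rewrite -e eqxx.
move=> e; apply: ord_inj; move: (ltn_ord i) (ltn_ord i') ig ig' e => /=.
rewrite -!leqNgt !ltnS; case: eqP => [->|ne]; case: eqP => [->|ne'] //= h1 h2 h3 h4 _.
have aux (m : nat) : (m <= g)%N -> (g.-1 <= m)%N -> m <> g.-1 -> m = g.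
  by move=> *; lia.
by rewrite (aux i) // (aux i').
Qed.

Definition prym_curve (a : 'M[K]_(g.-1, 2)) (ha : prym_parameters a) :
    binary_curve K g :=
  BinaryCurve (prym_node_inj ha).

Definition prym_glue (i : 'I_g.+1) : K :=
  if (i < g./2)%N || (i == g :> nat) then 1 else -1.

Lemma prym_glue_neq0 i : prym_glue i != 0.
Proof. by rewrite /prym_glue; case: ifP; rewrite ?oppr_eq0 oner_eq0. Qed.

Definition prym_gluing : gluing K g := Gluing prym_glue_neq0.

End PrymCanonical.

Definition zariski_open (K : fieldType) m n (U : 'M[K]_(m, n) -> Prop) : Prop :=
  exists S : {mpoly K[m * n]} -> Prop, forall a,
    U a <-> exists2 p, S p & p.@[fun i => mxvec a ord0 i] != 0.

(* Main.v *)
(** A section of the twisted dualizing sheaf is given by its residues [r_0, ..., r_n]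
    at the finite nodes of one component ([n = g - 1], the last node being [0]); the
    residues on the other component are those multiplied by minus the gluing data, and
    the residue theorem on both components says that the residues with gluing sign
    [-1] add up to [0]. This gives a basis of [n] sections, so that an element of the
    kernel of the Gaussian map is a vector of [n (n - 1) / 2] coefficients. Linear
    functionals on the differentials turn the vanishing of its image into linear
    equations on these coefficients: values of the Wronskian at points of either
    component and, at each node, the coefficient of the torsion differential
    [x dy = - y dx]. For [n = 11] there are [2 (2 g - 3) + (g + 1) = 55] such functionals,
    and [n (n - 1) / 2 = 55] unknowns. After clearing denominators the determinant of
    the system is a polynomial in the parameters; it is nonzero because it is nonzero
    modulo [101] at one integral choice of the parameters, for each [g]. *)

From Stdlib Require Import ZArith.
Require Import Defs.
From mathcomp Require Import all_boot all_order all_algebra.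
From mathcomp Require Import reals complex boolp.
From mathcomp Require Import ring zify ssrZ freeg mpoly.

Set Implicit Arguments.
Unset Strict Implicit.
Unset Printing Implicit Defensive.

Import GRing.Theory Num.Theory.
Local Open Scope ring_scope.

(** * Elimination modulo a prime, and the matrix of the equations *)

Section ModularElimination.
Variable p : Z.
Definition red (z : Z) : Z := Z.modulo z p.
Arguments red : simpl never.

(** Fraction-free elimination: cross multiplication by the leading entries avoids inverses modulo
    [p], and the leading column, which cancels, is dropped. *)
Definition eliminate (r s : seq Z) : seq Z :=
  [seq red (head 0 r * u.2 - head 0 s * u.1) | u <- zip (behead r) (behead s)].

(** The pivot row is eliminated with the others, and becomes zero. *)
Fixpoint trivial_kernel n (rows : seq (seq Z)) : bool :=
  if n is n'.+1 then
    let r := nth [::] rows (find (fun s => red (head 0 s) != 0) rows) in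
    (red (head 0 r) != 0) && trivial_kernel n' [seq eliminate r s | s <- rows]
  else true.

Section Soundness.
Variables (F : fieldType) (p_char : Z.to_nat p \in [pchar F]) (f : {rmorphism Z -> F}).

Lemma f_nat m : f (Z.of_nat m) = m%:R.
Proof.
have -> : Z.of_nat m = m%:R by lia.
by rewrite rmorph_nat.
Qed.

Lemma modulus_gt0 : Z.lt 0 p.
Proof.
have := prime_gt0 (pcharf_prime p_char); case: p => // q; lia.
Qed.

Lemma f_red z : f (red z) = f z.
Proof.
have p0 := modulus_gt0.
rewrite [in RHS](Z.div_mod z p); last by lia.
have <- : Z.of_nat (Z.to_nat p) = p by lia.
rewrite (rmorphD f) (rmorphM f) f_nat.
by rewrite (pcharf0 p_char) mul0r add0r Z2Nat.id //; lia.
Qed.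

Lemma f_neq0 z : red z != 0 -> f z != 0.
Proof.
have p0 := modulus_gt0.
have [z0 zp] : Z.le 0 (red z) /\ Z.lt (red z) p by apply: Z.mod_pos_bound; lia.
rewrite -f_red; move: (red z) z0 zp => {}z z0 zp nz.
rewrite -[z]Z2Nat.id // f_nat -(dvdn_pcharf p_char).
by rewrite gtnNdvd //; lia.
Qed.

Fixpoint dot (r : seq Z) (v : seq F) : F :=
  match r, v with
  | a :: r, b :: v => f a * b + dot r v
  | _, _ => 0
  end.

Lemma dot_eliminate r s v b : size r = (size v).+1 -> size s = (size v).+1 ->
  dot r (b :: v) = 0 -> dot s (b :: v) = 0 -> dot (eliminate r s) v = 0.
Proof.
rewrite /eliminate; case: r s => [|c r] [|d s] //= [hr] [hs].
suff -> : dot [seq red (c * u.2 - d * u.1) | u <- zip r s] v =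
    f c * dot s v - f d * dot r v.
  have cancel (c' d' r' s' : F) :
      c' * b + r' = 0 -> d' * b + s' = 0 -> c' * s' - d' * r' = 0.
    move=> e1 e2; have -> : c' * s' - d' * r' = c' * (d' * b + s') - d' * (c' * b + r') by ring.
    by rewrite e1 e2 !mulr0 subrr.
  exact: cancel.
elim: r s v hr hs => [|x r IH] [|y s] [|z v] //= => [_ _|[hr] [hs]].
  by rewrite !mulr0 subrr.
rewrite IH // f_red (rmorphB f) !(rmorphM f).
by rewrite mulrBl !mulrDr opprD !mulrA addrACA.
Qed.

(** Induction on the unknowns: the eliminated rows force the tail of [v] to vanish, and the pivot
    row then reads [f c * b = 0] with [c] nonzero modulo [p]. *)
Lemma trivial_kernelP rows v :
  trivial_kernel (size v) rows -> all (fun r => size r == size v) rows ->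
  all (fun r => dot r v == 0) rows -> all (fun b => b == 0) v.
Proof.
elim: v rows => //= b v IH rows; set i := find _ _.
move=> /andP[hc hker] hsize hdot.
(* If no pivot were found, [nth] would return the empty row, whose head is [0]. *)
have hi : (i < size rows)%N.
  by apply: contraTT hc; rewrite -leqNgt => /(nth_default [::]) ->.
move: (nth _ _ _) (mem_nth [::] hi) hc hker => r rin hc hker.
have size_r s : s \in rows -> size s = (size v).+1 by move/(allP hsize)/eqP.
have dot_r s : s \in rows -> dot s (b :: v) = 0 by move/(allP hdot)/eqP.
have v0 : all (fun b => b == 0) v.
  apply: IH hker _ _; apply/allP => _ /mapP[s sin ->]; apply/eqP.
    by rewrite size_map size_zip !size_behead !size_r ?minnn.
  by apply: dot_eliminate; [exact: size_r..|exact: dot_r|exact: dot_r].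
rewrite v0 andbT; have := dot_r _ rin; have := size_r _ rin.
case: r hc {rin hker} => //= c r hc _.
have -> : dot r v = 0.
  elim: v r v0 {IH hsize hdot size_r dot_r} => [|z v IHv] [|x r] //=.
  by move=> /andP[/eqP-> /IHv->]; rewrite mulr0 addr0.
rewrite addr0 => /eqP; rewrite mulf_eq0 => /orP[|//].
by move: hc => /f_neq0/negbTE->.
Qed.

Lemma det_neq0_mod n (e : nat -> nat -> Z) :
  trivial_kernel n (mkseq (fun i => mkseq (e i) n) n) ->
  \det (\matrix_(i < n, j < n) f (e i j)) != 0.
Proof.
(* [det0P] gives a vector killed on the left; after transposition it is annihilated by every row. *)
move=> hker; rewrite -det_tr; apply/det0P => -[v v0 hv].
pose s := [seq v ord0 i | i <- enum 'I_n].
have ss : size s = n by rewrite size_map size_enum_ord.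
have dotE (c : nat -> Z) m t : dot [seq c i | i <- iota m (size t)] t =
    \sum_(i < size t) f (c (m + i)%N) * t`_i.
  elim: t m => [|b t IH] m /=; first by rewrite big_ord0.
  rewrite big_ord_recl addn0 IH; congr (_ + _).
  by apply: eq_bigr => i _; rewrite addSnnS.
have : all (fun b => b == 0) s.
  apply: (@trivial_kernelP (mkseq (fun i => mkseq (e i) n) n)); rewrite ?ss //.
    by rewrite all_map; apply/allP => i _ /=; rewrite size_mkseq.
  rewrite all_map; apply/allP => i; rewrite mem_iota add0n => /= hi; apply/eqP.
  rewrite /mkseq -{1}ss dotE ss.
  move/rowP/(_ (Ordinal hi)): hv; rewrite !mxE => hv; rewrite -[RHS]hv.
  apply: eq_bigr => j _; rewrite !mxE mulrC; congr (_ * _).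
  by rewrite (nth_map j) ?size_enum_ord // nth_ord_enum.
move=> /allP s0; case/eqP: v0; apply/rowP => i; rewrite mxE.
by apply/eqP/s0/map_f; rewrite mem_enum.
Qed.
End Soundness.

End ModularElimination.

(** * Linear equations for the kernel of the Gaussian map *)

Section GaussMatrix.
Variables (n : nat).

(** [InftyTorsion] is the torsion at the node [[1,0]], and [PointValue j c] the
    value at the point [[c,1]] of [C_1] if [j = false], of [C_2] if [j = true]. *)
Variant probe := NodeTorsion of nat | InftyTorsion | PointValue of bool & nat.

(** These are as many as the dimension [5 * n] of the target when [n = 11]; the
    order is such that an initial segment suffices for smaller [n]. *)
Definition probes : seq probe :=
  InftyTorsion :: rev [seq NodeTorsion m | m <- iota 0 n.+1] ++
  [seq PointValue j c | c <- iota 1 21, j <- [:: false; true]].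

Definition pairs : seq (nat * nat) := [seq (i, j) | j <- iota 0 n, i <- iota 0 j].

Section Ring.
Variables (R : comNzRingType) (x y : nat -> R).

(** The gluing constant at the finite node [l]: since [g = n.+1], the bound is $k=\lfloor
    g/2\rfloor$. *)
Definition sign (l : nat) : R := if (l < n.+1./2)%N then 1 else -1.

(** For [e = [:: l]] this is $1/(c-z_l)$ multiplied by the common denominator of all the poles,
    hence a polynomial in the nodes. *)
Definition copole (z : nat -> R) (c : R) (e : seq nat) : R :=
  foldr *%R 1 [seq c - z q | q <- iota 0 n.+1 & q \notin e].

(** The functional [b] evaluated at the image of [s /\ s'] is proportional to
    [left s * right s' - left s' * right s], where [left] and [right] are
    linear forms in the residues of [s]. *)
Definition left_form (b : probe) (l : nat) : R :=
  match b with
  | NodeTorsion m => if l == m then 0 else copole x (x m) [:: l; m]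
  | InftyTorsion => x l
  | PointValue j c => (if j then sign l else 1) * copole (if j then y else x) c%:R [:: l]
  end.

(** At a point, the derivative of a simple pole is minus the square of its value, hence the second
    factor [copole]. *)
Definition right_form (b : probe) (l : nat) : R :=
  match b with
  | NodeTorsion m => if l == m then 0 else sign l * copole y (y m) [:: l; m]
  | InftyTorsion => sign l * y l
  | PointValue j c => left_form b l * copole (if j then y else x) c%:R [:: l]
  end.

(** The basis section number [i] has residue vector [e_i] if [i < (n + 1) / 2], and
    [e_i - e_n] otherwise. *)
Definition at_basis (form : nat -> R) (i : nat) : R :=
  form i - (if (i < n.+1./2)%N then 0 else form n).

Definition gauss_entry (b : probe) (ij : nat * nat) : R :=
  at_basis (left_form b) ij.1 * at_basis (right_form b) ij.2 -
  at_basis (left_form b) ij.2 * at_basis (right_form b) ij.1.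

Definition gauss_matrix : 'M[R]_(size pairs) :=
  \matrix_(m, q) gauss_entry (nth InftyTorsion probes m) (nth (0, 0)%N pairs q).
End Ring.

Lemma copole_rmorph (R S : comNzRingType) (f : {rmorphism R -> S}) z c e :
  f (copole z c e) = copole (f \o z) (f c) e.
Proof.
rewrite /copole; elim: [seq q <- _ | _] => [|q s IH] /=; first exact: rmorph1.
by rewrite rmorphM rmorphB IH.
Qed.

Lemma sign_rmorph (R S : comNzRingType) (f : {rmorphism R -> S}) l :
  f (sign R l) = sign S l.
Proof. by rewrite /sign; case: ifP; rewrite ?rmorphN rmorph1. Qed.

(** The entries are polynomials in the nodes with integral coefficients. This serves both to
    evaluate the matrix of indeterminates and to carry an integral sample into a field. *)
Lemma gauss_matrix_rmorph (R S : comNzRingType) (f : {rmorphism R -> S}) x y :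
  map_mx f (gauss_matrix x y) = gauss_matrix (f \o x) (f \o y).
Proof.
have lE b l : f (left_form x y b l) = left_form (f \o x) (f \o y) b l.
  case: b => [m||j c] //=.
    by case: ifP; rewrite ?rmorph0 // copole_rmorph.
  by case: j; rewrite ?mul1r ?rmorphM ?sign_rmorph copole_rmorph rmorph_nat.
have rE b l : f (right_form x y b l) = right_form (f \o x) (f \o y) b l.
  case: b => [m||j c]; rewrite /right_form.
  - by case: ifP; rewrite ?rmorph0 // rmorphM sign_rmorph copole_rmorph.
  - by rewrite rmorphM sign_rmorph.
  - by rewrite rmorphM lE; case: j; rewrite copole_rmorph rmorph_nat.
apply/matrixP => i j; rewrite !mxE /gauss_entry /at_basis.
rewrite rmorphB !rmorphM !rmorphB !lE !rE.
by do !case: ifP => _; rewrite ?rmorph0 ?lE ?rE.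
Qed.

End GaussMatrix.

(** The default value matters: index [n] is the node [[0,1]], of coordinate [0]. *)
Definition node_value (R : nmodType) n (a : 'M[R]_(n, 2)) (j : 'I_2) (l : nat) : R :=
  if insub l is Some i then a i j else 0.

Definition parameter_matrix (R : comNzRingType) n (a : 'M[R]_(n, 2)) : 'M[R]_(size (pairs n)) :=
  gauss_matrix n (node_value a ord0) (node_value a ord_max).

Lemma parameter_matrix_rmorph (R S : comNzRingType) (f : {rmorphism R -> S}) n
  (a : 'M[R]_(n, 2)) :
  map_mx f (parameter_matrix a) = parameter_matrix (map_mx f a).
Proof.
rewrite /parameter_matrix gauss_matrix_rmorph; congr (gauss_matrix _ _ _);
  apply/funext => l; rewrite /= /node_value; case: insubP => [i _ _|_];
  by rewrite ?mxE ?rmorph0.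
Qed.

(** A single polynomial suffices: the determinant of the matrix [X] of indeterminates, which
    evaluates to the determinant at [a]. *)
Lemma parameter_matrix_open (K : fieldType) n :
  zariski_open (fun a : 'M[K]_(n, 2) => \det (parameter_matrix a) != 0).
Proof.
pose X : 'M[{mpoly K[n * 2]}]_(n, 2) := \matrix_(i, j) 'X_(mxvec_index i j).
have XE a : \det (parameter_matrix a) =
    (\det (parameter_matrix X)).@[fun i => mxvec a ord0 i].
  rewrite -(det_map_mx (meval _)) parameter_matrix_rmorph; congr (\det (parameter_matrix _)).
  apply/matrixP => i j; rewrite !mxE -[LHS](mxvecE a i j).
  exact/esym/mevalXU.
exists (eq (\det (parameter_matrix X))) => a; rewrite XE.
by split=> [?|[_ <-]] //; exists (\det (parameter_matrix X)).
Qed.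

(** * An integral sample of the parameters, checked modulo 101 *)

Section Sample.
Variable n : nat.

(** The nodes are negative, apart from the node [0] at index [n], so that they avoid the positive
    points at which values are taken. *)
Definition sample_node (j : bool) (l : nat) : Z :=
  if (l < n)%N then (if j then - 2 ^+ l else - Z.of_nat l.+1) else 0.

Definition sample : 'M[Z]_(n, 2) := \matrix_(i, j) sample_node (j != ord0) i.

Lemma node_value_sample j : node_value sample j = sample_node (j != ord0).
Proof.
apply/funext => l; rewrite /node_value; case: insubP => [i _ <-|ln]; first by rewrite mxE.
by rewrite /sample_node (negbTE ln).
Qed.

Definition modulus : Z := Z.of_nat 101.

(** For the sake of computation, the two linear forms are reduced and tabulated once for the whole
    row. *)
Definition sample_row (b : probe) : seq Z :=
  let left := mkseq (red modulus \o
    at_basis n (left_form n (sample_node false) (sample_node true) b)) n in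
  let right := mkseq (red modulus \o
    at_basis n (right_form n (sample_node false) (sample_node true) b)) n in
  [seq nth 0 left ij.1 * nth 0 right ij.2 - nth 0 left ij.2 * nth 0 right ij.1
     | ij <- pairs n].

Lemma det_sample :
  trivial_kernel modulus (size (pairs n))
    (mkseq (fun m => sample_row (nth InftyTorsion (probes n) m)) (size (pairs n))) ->
  \det (parameter_matrix sample) != 0.
Proof.
set N := size (pairs n) => hker.
move: (intr \o int_of_Z : {rmorphism Z -> 'F_101}) => f.
have p_char : Z.to_nat modulus \in [pchar 'F_101] by exact: pchar_Fp.
have row_mkseq b : sample_row b = mkseq (fun q => nth 0 (sample_row b) q) N.
  by rewrite -[LHS](mkseq_nth 0) size_map.
have {}hker : trivial_kernel modulus N (mkseq (fun m => mkseq
    (fun q => nth 0 (sample_row (nth InftyTorsion (probes n) m)) q) N) N).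
  by under eq_mkseq => m do rewrite -row_mkseq.
have := det_neq0_mod p_char f hker.
rewrite (_ : \matrix_(i, j) _ = map_mx f (parameter_matrix sample)).
  by rewrite det_map_mx; apply: contraNneq => ->; rewrite rmorph0.
rewrite /parameter_matrix !node_value_sample; apply/matrixP => m q; rewrite !mxE.
rewrite /sample_row (@nth_map _ (0, 0)%N _ 0 _ q _ (ltn_ord q)).
move: (mem_nth (0, 0)%N (ltn_ord q)).
case/allpairsPdep => j [i []]; rewrite !mem_iota /= => hj hi ->.
rewrite !nth_mkseq /=; try lia.
by rewrite !(rmorphB f) !(rmorphM f) !(f_red p_char).
Qed.
End Sample.

(** In characteristic zero a nonzero integral determinant stays nonzero in [K]; the ten values of
    [n] are settled by computation. *)
Lemma parameter_matrix_generic (K : numFieldType) n : (1 < n < 12)%N ->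
  exists a : 'M[K]_(n, 2), \det (parameter_matrix a) != 0.
Proof.
move=> hn; pose f : {rmorphism Z -> K} := intr \o int_of_Z.
exists (map_mx f (sample n)); rewrite -parameter_matrix_rmorph det_map_mx.
rewrite /f /= intr_eq0; have -> : (0 = int_of_Z 0) by [].
rewrite (can_eq int_of_ZK); apply: det_sample.
have {hn} : n \in iota 2 10 by rewrite mem_iota; lia.
apply/allP: n {f}; by vm_compute.
Qed.

(** * Jets of rational functions on the projective line *)

Section Jets.
Variable K : fieldType.
Implicit Types (p : P1 K) (f : ratfun K).
Local Notation t := (ratfun_t K).

Lemma poly_ratfunC (k : K) : poly_ratfun k%:P = k%:A :> ratfun K.
Proof. by rewrite -[RHS]/(ratfun_const k * 1) mulr1. Qed.

Lemma poly_ratfunXsubC (c : K) : poly_ratfun ('X - c%:P) = t - c%:A :> ratfun K.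
Proof. by rewrite rmorphB /= poly_ratfunC. Qed.

Lemma horner_alg_comp (P Q : {poly K}) :
  horner_alg (poly_ratfun Q) P = poly_ratfun (P \Po Q) :> ratfun K.
Proof.
elim/poly_ind: P => [|P c IH]; first by rewrite comp_poly0 !rmorph0.
rewrite comp_poly_MXaddC !rmorphD !rmorphM /= IH horner_algX horner_algC.
by rewrite poly_ratfunC.
Qed.

Lemma has_value_poly (c : K) (P : {poly K}) : has_value (Some c) (poly_ratfun P) P.[c].
Proof.
(* The Taylor shift of [P] expresses it in the coordinate [t - c]. *)
exists (P \Po ('X + c%:P)), 1; split; first by rewrite hornerC oner_neq0.
  rewrite rmorph1 mulr1 /= -poly_ratfunXsubC horner_alg_comp -comp_polyA.
  by rewrite comp_polyD comp_polyX comp_polyC subrK comp_polyXr.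
by rewrite horner_comp !hornerE divr1.
Qed.

Lemma has_value_unif p : has_value p (unif p) 0.
Proof.
exists 'X, 1; split; first by rewrite hornerC oner_neq0.
  by rewrite rmorph1 mulr1 horner_algX.
by rewrite hornerX mul0r.
Qed.

Lemma has_value_unifX p m : has_value p (unif p ^+ m.+1) 0.
Proof.
elim: m => [|m IH]; first exact: has_value_unif.
by rewrite exprS -(mulr0 0); apply: has_valueM => //; apply: has_value_unif.
Qed.

(** Dividing by $t^d$ turns [P] into a polynomial in $1/t$ whose constant term is the coefficient of
    $t^d$. *)
Lemma has_value_infty_poly (P : {poly K}) d :
  (size P <= d.+1)%N -> has_value None (poly_ratfun P / t ^+ d) P`_d.
Proof.
elim/poly_ind: P d => [|P c IH] d hd.
  by rewrite rmorph0 mul0r coef0; apply: has_value0.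
have := hd; rewrite coefD coefMX coefC rmorphD rmorphM /= poly_ratfunC.
case: d {hd} => [|d] hd /=.
  have -> : P = 0.
    apply/eqP; apply: contraTT hd => P0.
    by rewrite size_MXaddC (negbTE P0) /= -ltnNge !ltnS lt0n size_poly_eq0.
  by rewrite rmorph0 mul0r !add0r divr1; apply: has_valueC.
rewrite mulrDl; apply: has_valueD; last first.
  by rewrite -exprVn mulr_algl -(mulr0 c); apply/has_valueZ/(has_value_unifX None).
rewrite exprSr -mulf_div divff ?ratfun_t_neq0 // mulr1.
apply: IH; case: (eqVneq P 0) => [->|P0]; first by rewrite size_poly0.
by move: hd; rewrite size_MXaddC (negbTE P0) /= ltnS.
Qed.

(** At [[1,0]], a polynomial relation satisfied by [t^-1] becomes one satisfied by
    [t] after multiplication by a power of [t]. *)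
Lemma has_value0_eq0 p (v : K) : has_value p 0 v -> v = 0.
Proof.
move=> [P [Q [Q0 /esym]]]; rewrite mul0r => hP ->; suff -> : P.[0] = 0 by rewrite mul0r.
case: p hP => [c|] /= /eqP.
  rewrite -poly_ratfunXsubC horner_alg_comp poly_ratfun_eq0 => /eqP hP.
  have : (P \Po ('X - c%:P)).[c] = 0 by rewrite hP horner0.
  by rewrite horner_comp !hornerE subrr.
suff [d [R [e <- sR]]] : exists d R, [/\ t ^+ d * horner_alg t^-1 P = poly_ratfun R,
    R`_d = P.[0] & (size R <= d.+1)%N].
  move=> /eqP hP; move: e; rewrite hP mulr0 => /esym/eqP.
  by rewrite poly_ratfun_eq0 => /eqP->; rewrite coef0.
elim/poly_ind: P {Q Q0} => [|P c [d [R [e hR sR]]]].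
  by exists 0%N, 0; rewrite !rmorph0 mulr0 coef0 horner0 size_poly0.
exists d.+1, (R + c%:P * 'X^(d.+1)); split.
- rewrite [horner_alg _ _]rmorphD rmorphM /= horner_algX horner_algC.
  rewrite rmorphD rmorphM rmorphXn /= -e poly_ratfunC -/t mulrDr [_%:A * _]mulrC; congr (_ + _).
  by rewrite exprSr mulrACA divff ?ratfun_t_neq0 ?mulr1.
- by rewrite coefD coefCM coefXn eqxx mulr1 nth_default // add0r hornerMXaddC mulr0 add0r.
- rewrite (leq_trans (size_polyD _ _)) // geq_max (leqW sR) (leq_trans (size_polyMleq _ _)) //.
  by rewrite size_polyXn size_polyC; case: (c != 0).
Qed.

Lemma has_value_uniq p f v v' : has_value p f v -> has_value p f v' -> v = v'.
Proof.
move=> h h'; apply/eqP; rewrite -subr_eq0; apply/eqP/(@has_value0_eq0 p).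
by rewrite -(subrr f); apply: has_valueD => //; apply: has_valueN.
Qed.

Lemma has_value0_div p f : has_value p f 0 -> regular p (f / unif p).
Proof.
move=> [P [Q [Q0 hf /esym/eqP]]]; rewrite mulf_eq0 invr_eq0 (negbTE Q0) orbF.
move=> /factor_theorem[R eP]; exists (R.[0] / Q.[0]), R, Q; split=> //.
move: hf; rewrite eP subr0 rmorphM /= horner_algX mulrAC => ->.
by rewrite mulfK ?unif_neq0.
Qed.

Lemma regularD p f f' : regular p f -> regular p f' -> regular p (f + f').
Proof. by move=> [v h] [v' h']; exists (v + v'); apply: has_valueD. Qed.

Lemma regularM p f f' : regular p f -> regular p f' -> regular p (f * f').
Proof. by move=> [v h] [v' h']; exists (v * v'); apply: has_valueM. Qed.

Lemma regularZ p k f : regular p f -> regular p (k *: f).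
Proof. by move=> [v h]; exists (k * v); apply: has_valueZ. Qed.

Lemma regularC p k : regular p k%:A.
Proof. by exists k; apply: has_valueC. Qed.

Lemma regular_unif p : regular p (unif p).
Proof. by exists 0; apply: has_value_unif. Qed.

Lemma regular_sum_in p (I : eqType) (r : seq I) (F : I -> ratfun K) :
  (forall i, i \in r -> regular p (F i)) -> regular p (\sum_(i <- r) F i).
Proof.
move=> h; rewrite big_seq; elim/big_rec: _ => [|i f /h hi hf].
  by rewrite -(scale0r 1); apply: regularC.
exact: regularD.
Qed.

Lemma ratfun_algM (a b : K) : (a * b)%:A = a%:A * b%:A :> ratfun K.
Proof. by rewrite mulr_algl scalerA. Qed.

(** First-order Taylor expansion; the derivative is taken in [unif p], that is, in $1/t$ at
    [None]. *)
Definition has_jet p f (j : K * K) : Prop :=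
  exists2 r, regular p r & f = j.1%:A + j.2 *: unif p + unif p ^+ 2 * r.

Lemma has_jet_value p f j : has_jet p f j -> has_value p f j.1.
Proof.
move=> [r [v hr] ->].
have {2}-> : j.1 = j.1 + j.2 * 0 + 0 * v by rewrite mulr0 mul0r !addr0.
apply: has_valueD; last by apply: has_valueM => //; apply: (has_value_unifX _ 1).
apply: has_valueD; first exact: has_valueC.
by apply: has_valueZ; apply: has_value_unif.
Qed.

Lemma has_jet_regular p f j : has_jet p f j -> regular p f.
Proof. by move=> /has_jet_value; exists j.1. Qed.

Lemma has_jet_slope p f j : has_jet p f j -> has_value p ((f - j.1%:A) / unif p) j.2.
Proof.
move=> [r [v hr] ->]; set u := unif p.
have -> : (j.1%:A + j.2 *: u + u ^+ 2 * r - j.1%:A) / u = j.2%:A + u * r.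
  rewrite -[_ + _ + u ^+ 2 * r]addrA [j.1%:A + _]addrC addrK mulrDl expr2 -scalerAl divff ?unif_neq0 //.
  by congr (_ + _); rewrite -mulrA mulrAC divff ?unif_neq0 // mul1r.
have {2}-> : j.2 = j.2 + 0 * v by rewrite mul0r addr0.
apply: has_valueD; first exact: has_valueC.
by apply: has_valueM => //; apply: has_value_unif.
Qed.

Lemma has_jet_uniq p f j j' : has_jet p f j -> has_jet p f j' -> j = j'.
Proof.
move=> h h'; have e := has_value_uniq (has_jet_value h) (has_jet_value h').
have := has_value_uniq (has_jet_slope h); rewrite e => /(_ _ (has_jet_slope h')).
by case: j j' e {h h'} => v d [v' d'] /= -> ->.
Qed.

(** Subtracting the value and dividing by [unif p] keeps a function regular; doing this twice
    produces the slope and the remainder. *)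
Lemma regular_has_jet p f : regular p f -> exists j, has_jet p f j.
Proof.
have hsub h v : has_value p h v -> regular p ((h - v%:A) / unif p).
  move=> hv; apply: has_value0_div; rewrite -(subrr v).
  by apply: has_valueD => //; apply/has_valueN/has_valueC.
move=> [v hv]; have [d hd] := hsub _ _ hv.
exists (v, d); exists (((f - v%:A) / unif p - d%:A) / unif p); first exact: hsub.
have u0 := unif_neq0 p; rewrite /= expr2 -mulrA mulrC -mulrA divfK //.
by rewrite mulrBr mulrC divfK // mulr_algr addrAC -addrA subrK addrC subrK.
Qed.

Lemma has_jet_lin p k f f' j j' :
  has_jet p f j -> has_jet p f' j' ->
  has_jet p (k *: f + f') (k * j.1 + j'.1, k * j.2 + j'.2).
Proof.
move=> [r hr ->] [r' hr' ->]; exists (k *: r + r'); first exact/regularD/hr'/regularZ.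
rewrite /= -![_ *: unif p]mulr_algl -![_ *: r]mulr_algl -[k *: (_ + _)]mulr_algl.
by rewrite !scalerDl !ratfun_algM; ring.
Qed.

Lemma has_jetM p f f' j j' : has_jet p f j -> has_jet p f' j' ->
  has_jet p (f * f') (j.1 * j'.1, j.1 * j'.2 + j'.1 * j.2).
Proof.
case: j j' => [v d] [v' d'] [r hr ->] [r' hr' ->]; rewrite /=; set u := unif p.
exists (v *: r' + v' *: r + (d * d')%:A + d *: (u * r') + d' *: (u * r) + u ^+ 2 * (r * r')).
  have hu : regular p u by apply: regular_unif.
  apply: regularD; last by do 2!apply: regularM.
  apply: regularD; last exact/regularZ/regularM.
  apply: regularD; last exact/regularZ/regularM.
  apply: regularD; last exact: regularC.
  by apply: regularD; apply: regularZ.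
rewrite -![_ *: u]mulr_algl -![_ *: r]mulr_algl -![_ *: r']mulr_algl -![_ *: (u * _)]mulr_algl.
by rewrite scalerDl !ratfun_algM -/u; ring.
Qed.

Lemma has_jetC p k : has_jet p k%:A (k, 0).
Proof.
exists 0; first by exists 0; apply: has_value0.
by rewrite /= scale0r mulr0 !addr0.
Qed.

Lemma has_jet0 p : has_jet p 0 0.
Proof. by rewrite -[X in has_jet p X](scale0r 1); apply: has_jetC. Qed.

Lemma has_jet_sum p m (c : nat -> K) (F : nat -> ratfun K) j :
  (forall l, (l < m)%N -> has_jet p (F l) (j l)) ->
  has_jet p (\sum_(l < m) c l *: F l)
    (\sum_(l < m) c l * (j l).1, \sum_(l < m) c l * (j l).2).
Proof.
elim: m => [|m IH] h; first by rewrite !big_ord0; apply: has_jet0.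
rewrite !big_ord_recr /=.
have := has_jet_lin (c m) (h m (ltnSn m)) (IH (fun l hl => h l (ltnW hl))).
by rewrite /= (addrC (c m *: _)) (addrC (c m * (j m).1)) (addrC (c m * (j m).2)).
Qed.

Lemma has_jet_unif p : has_jet p (unif p) (0, 1).
Proof.
exists 0; first by exists 0; apply: has_value0.
by rewrite /= scale0r scale1r mulr0 add0r addr0.
Qed.

Definition jet p f : K * K :=
  if pselect (exists j, has_jet p f j) is left h then sval (cid h) else 0.

Lemma jetP p f j : has_jet p f j -> jet p f = j.
Proof.
move=> h; rewrite /jet; case: pselect => [h'|[]]; last by exists j.
exact: has_jet_uniq (svalP (cid h')) h.
Qed.

Lemma has_jet_jet p f : regular p f -> has_jet p f (jet p f).
Proof. by move=> /regular_has_jet[j h]; rewrite (jetP h). Qed.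

Lemma jet_lin p k f f' : regular p f -> regular p f' ->
  jet p (k *: f + f') = (k * (jet p f).1 + (jet p f').1, k * (jet p f).2 + (jet p f').2).
Proof. by move=> h h'; apply/jetP/has_jet_lin; apply: has_jet_jet. Qed.

Lemma jetM p f f' : regular p f -> regular p f' ->
  jet p (f * f') = ((jet p f).1 * (jet p f').1,
                    (jet p f).1 * (jet p f').2 + (jet p f').1 * (jet p f).2).
Proof. by move=> h h'; apply/jetP/has_jetM; apply: has_jet_jet. Qed.

Lemma regular_pole (c z : K) : c != z -> regular (Some c) (t - z%:A)^-1.
Proof.
move=> cz; have [v [_ _ hv]] : unit_at (Some c) (unif (Some z))^-1.
  by apply/unit_atV/unit_at_unif => // -[e]; rewrite e eqxx in cz.
by exists v.
Qed.

Lemma has_jet_pole (c z : K) : c != z ->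
  has_jet (Some c) (t - z%:A)^-1 ((c - z)^-1, - (c - z)^-2).
Proof.
move=> cz; have cz0 : c - z != 0 by rewrite subr_eq0.
exists ((c - z)^-2 *: (t - z%:A)^-1); first exact/regularZ/regular_pole.
have tz0 := ratfun_tB_neq0 z; rewrite /=.
have e : (t - z%:A)^-1 = (c - z)^-1%:A * (1 - (t - c%:A) / (t - z%:A)).
  have -> : 1 - (t - c%:A) / (t - z%:A) = (t - z%:A - (t - c%:A)) / (t - z%:A).
    by rewrite [RHS]mulrBl divff.
  have -> : t - z%:A - (t - c%:A) = (c - z)%:A by rewrite scalerBl; ring.
  by rewrite mulrA -ratfun_algM mulVf // scale1r mul1r.
(* Substituting the relation into itself gives the second-order remainder. *)
have expand (v u w : ratfun K) : w = v * (1 - u * w) ->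
    w = v - v * v * u + u ^+ 2 * (v * v * w).
  by move=> ew; rewrite {1}ew [in LHS]ew; ring.
rewrite scaleNr -[_ *: (t - c%:A)]mulr_algl -[_ *: (t - z%:A)^-1]mulr_algl -exprVn.
by rewrite (expr2 (c - z)^-1) ratfun_algM; apply: expand.
Qed.

(** The slope at the pole itself is [0^-1 = 0]. *)
Lemma has_jet_pole_unif (c z : K) :
  has_jet (Some c) ((t - c%:A) / (t - z%:A)) ((c == z)%:R, (c - z)^-1).
Proof.
have [<-|cz] := eqVneq c z.
  rewrite subrr invr0 divff ?ratfun_tB_neq0 // -[X in has_jet _ X](scale1r 1).
  exact: has_jetC.
have := has_jetM (has_jet_unif (Some c)) (has_jet_pole cz).
by rewrite /= !mul0r add0r mulr1.
Qed.

(** These are the first two terms of the geometric series of $1/(1-z t^{-1})$. *)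
Lemma has_jet_infty_pole (z : K) : has_jet None (t / (t - z%:A)) (1, z).
Proof.
have t0 := @ratfun_t_neq0 K; have tz0 := ratfun_tB_neq0 z.
have e : t / (t - z%:A) = 1 + z%:A * t^-1 * (t / (t - z%:A)).
  rewrite -mulrA [t^-1 * _]mulrA mulVf // mul1r.
  by rewrite -{1}[t](subrK z%:A) mulrDl divff.
have expand (a u w : ratfun K) : w = 1 + a * u * w -> w = 1 + a * u + u ^+ 2 * (a * a * w).
  by move=> ew; rewrite {1}ew [in LHS]ew; ring.
exists ((z ^+ 2) *: (t / (t - z%:A))); last first.
  rewrite /= scale1r -[z *: t^-1]mulr_algl -[_ *: (t / _)]mulr_algl expr2 ratfun_algM.
  exact: expand.
apply: regularZ; exists 1, 1, (1 - z%:P * 'X); split.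
- by rewrite !hornerE subr0 oner_neq0.
- rewrite rmorphB rmorphM !rmorph1 /= horner_algC horner_algX mulrAC -[RHS](divff tz0).
  by congr (_ / _); rewrite mulrBr mulr1 mulrCA divff // mulr1.
by rewrite !hornerE ?mulr0 ?subr0 ?invr1 ?divr1 ?mulr1.
Qed.

End Jets.

(** * Global regularity over an algebraically closed field *)

Section ClosedField.
Variable K : closedFieldType.
Implicit Types f : ratfun K.
Local Notation t := (ratfun_t K).

(** A nonconstant denominator has a root; regularity there makes it a root of the numerator too, and
    the common factor cancels. The induction is on the size of the denominator. *)
Lemma regular_poly f : (forall c, regular (Some c) f) -> exists P, f = poly_ratfun P.
Proof.
move=> hf; have [P [Q [Q0 ef]]] := poly_ratfun_frac f.
have {ef} ef : f * poly_ratfun Q = poly_ratfun P by rewrite ef divfK // poly_ratfun_eq0.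
have [m] := ubnP (size Q); elim: m => // m IH in P Q Q0 ef *; rewrite ltnS => sQ.
have [/size_poly1P[k k0 eQ]|/closed_rootP[c rQ]] := boolP (size Q == 1%N).
  exists (k^-1 *: P); rewrite -mul_polyC rmorphM /= poly_ratfunC -ef eQ poly_ratfunC.
  by rewrite mulrCA -ratfun_algM mulVf // scale1r mulr1.
have rP : root P c.
  have [v hv] := hf c; apply/eqP.
  have := has_valueM hv (has_value_poly c Q).
  by rewrite ef (eqP rQ) mulr0; apply: has_value_uniq; apply: has_value_poly.
have [Q' eQ] := factor_theorem _ _ rQ; have [P' eP] := factor_theorem _ _ rP.
have Q'0 : Q' != 0 by apply: contraNneq Q0; rewrite eQ => ->; rewrite mul0r.
apply: (IH P' Q') => //; last first.
  by rewrite (leq_trans _ sQ) // eQ size_Mmonic ?monicXsubC // size_XsubC addn2.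
have X0 : poly_ratfun ('X - c%:P) != 0 :> ratfun K by rewrite poly_ratfun_eq0 polyXsubC_eq0.
by apply: (mulIf X0); rewrite -mulrA -!rmorphM -eQ -eP.
Qed.

(** This is $H^0(\mathbb P^1,\mathcal O(-1))=0$. If [f] is a polynomial of degree $d$, its leading
    coefficient is the value at infinity of $f/t^d=(ft)\,t^{-(d+1)}$, which is zero. *)
Lemma regular_eq0 f v : (forall c, regular (Some c) f) -> has_value None (f * t) v -> f = 0.
Proof.
move=> /regular_poly[P ->] hv; apply/eqP; rewrite poly_ratfun_eq0 -lead_coef_eq0.
apply/eqP; rewrite lead_coefE; apply: (@has_value_uniq _ None).
  exact/has_value_infty_poly/leqSpred.
have := has_valueM hv (has_value_unifX None (size P).-1).
by rewrite mulr0 /= exprVn exprSr -mulf_div divff ?ratfun_t_neq0 // mulr1.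
Qed.

End ClosedField.

(** * Sections and their residues *)

Section Twisted.
Variables (K : fieldType) (g : nat) (C : binary_curve K g) (h : gluing K g).

Lemma twisted_smooth j p hp (f : ratfun K) :
  twisted_dualizing (C := C) h (x := @Smooth K g C j p hp) f <-> regular_form p f.
Proof.
split=> [[r hr ->]|hf].
  rewrite /regular_form mulr_suml; apply: regular_sum_in => u /hr[h1 h2].
  by rewrite mulrAC; apply: regularM.
exists [:: (f, 1)]; last by rewrite big_seq1 mulr1.
move=> u; rewrite inE => /eqP-> /=; split=> //.
by exists 1; apply: has_value1.
Qed.

(** Residues [sig] and [- sig] times values [v] and [h i * v] give a pair of the stated shape.
    Conversely, the generator [(1, h i)] of the bundle is factored out. *)
Lemma twisted_node i (s : ratfun K * ratfun K) :
  twisted_dualizing (C := C) h (x := Node C i) s <->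
  exists rho, has_residue (C ord0 i) s.1 rho /\ has_residue (C ord_max i) s.2 (- (h i * rho)).
Proof.
split=> [[r hr ->]|[rho [h1 h2]]].
  have comm (x y d u : ratfun K) : x * y * d * u = x * d * u * y by ring.
  elim: r hr => [|u r IH] hr.
    rewrite big_nil; exists 0; rewrite /has_residue /= !mul0r mulr0 oppr0.
    by split; apply: has_value0.
  have [rho [h1 h2]] := IH (fun v vr => hr v (mem_behead (s := u :: r) vr)).
  have [[sig [s1 s2]] [v [v1 v2]]] := hr u (mem_head _ _).
  rewrite big_cons; exists (sig * v + rho); split.
    by rewrite /has_residue /= !mulrDl; apply: has_valueD => //; rewrite comm; apply: has_valueM.
  have -> : - (h i * (sig * v + rho)) = (- sig) * (h i * v) - h i * rho by ring.
  by rewrite /has_residue /= !mulrDl; apply: has_valueD => //; rewrite comm; apply: has_valueM.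
have h0 := glue_neq0 h i.
exists [:: ((s.1, (h i)^-1 *: s.2), (1, (h i)%:A))].
  move=> u; rewrite inE => /eqP-> /=; split.
    exists rho; split => //=; rewrite /has_residue -!scalerAl.
    have -> : - rho = (h i)^-1 * (- (h i * rho)) by rewrite mulrN mulKf.
    exact: has_valueZ.
  exists 1; split; first exact: has_value1.
  by rewrite mulr1; apply: has_valueC.
rewrite big_seq1 /=; case: s {h1 h2} => s1 s2; congr pair; rewrite /= ?mulr1 //.
by rewrite -scalerAl mulr_algr scalerA mulVf // scale1r.
Qed.

End Twisted.

Section PrymSections.
Variables (K : numClosedFieldType) (n : nat).
Variables (a : 'M[K]_(n, 2)) (ha : @prym_parameters K n.+1 a).
Local Notation C := (prym_curve ha).
Local Notation h := (prym_gluing K n.+1).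
Local Notation t := (ratfun_t K).
Local Notation node j := (node_value a j).
Local Notation sg := (sign n K).

Lemma node_value_lt (i : 'I_n) j : node j i = a i j.
Proof. by rewrite /node_value insubT //= => hi; congr (a _ j); apply: val_inj. Qed.

Lemma node_value_last j : node j n = 0.
Proof. by rewrite /node_value insubF ?ltnn. Qed.

Lemma node_value_inj j l l' : (l <= n)%N -> (l' <= n)%N -> node j l = node j l' -> l = l'.
Proof.
have [a0 ainj] := ha.
have lt_neq0 k : (k < n)%N -> node j k != 0 by move=> hk; rewrite (node_value_lt (Ordinal hk)) a0.
rewrite (leq_eqVlt l) (leq_eqVlt l') => /orP[/eqP->|hl] /orP[/eqP->|hl'] //.
- by move=> e; have := lt_neq0 _ hl'; rewrite -e node_value_last eqxx.
- by move=> e; have := lt_neq0 _ hl; rewrite e node_value_last eqxx.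
rewrite (node_value_lt (Ordinal hl)) (node_value_lt (Ordinal hl')).
by move=> /(ainj j) [].
Qed.

Lemma prym_nodeE j (i : 'I_n.+2) : C j i = if (i <= n)%N then Some (node j i) else None.
Proof.
rewrite /= /prym_node /node_value /= leq_eqVlt; case: insubP => [k hk ek|hk].
  by rewrite hk orbT.
by rewrite (negbTE hk) orbF.
Qed.

Lemma prym_node_infty j : C j ord_max = None.
Proof. by rewrite prym_nodeE /= ltnn. Qed.

Lemma prym_glueE (i : 'I_n.+2) : h i = if (i <= n)%N then sg i else 1.
Proof.
rewrite /= /prym_glue /sign; have := ltn_ord i; rewrite !ltnS => hi.
have [e|e] := eqVneq (i : nat) n.+1; first by rewrite e ltnn orbT.
by rewrite orbF (_ : (i <= n)%N) //; lia.
Qed.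

Lemma sign_sq l : sg l * sg l = 1.
Proof. by rewrite /sign; case: ifP; rewrite ?mulrNN mulr1. Qed.

(** The form with residues [r l] at the points [z l], in partial fractions. *)
Definition polar_form (z r : nat -> K) : ratfun K :=
  \sum_(l < n.+1) r l *: (t - (z l)%:A)^-1.

Lemma has_jet_polar_form z r c : (forall l, (l <= n)%N -> c != z l) ->
  has_jet (Some c) (polar_form z r)
    (\sum_(l < n.+1) r l * (c - z l)^-1, \sum_(l < n.+1) r l * (- (c - z l)^-2)).
Proof.
move=> hc; apply: (@has_jet_sum _ _ _ r (fun l => (t - (z l)%:A)^-1)
  (fun l => ((c - z l)^-1, - (c - z l)^-2))) => l hl.
by apply/has_jet_pole/hc.
Qed.

Lemma has_jet_polar_node j r m : (m <= n)%N ->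
  has_jet (Some (node j m)) (polar_form (node j) r * (t - (node j m)%:A))
    (r m, \sum_(l < n.+1) r l * (node j m - node j l)^-1).
Proof.
move=> hm; rewrite /polar_form mulr_suml.
have -> : r m = \sum_(l < n.+1) r l * (node j m == node j l)%:R.
  rewrite (bigD1 (inord m)) //= inordK ?ltnS // eqxx mulr1 big1 ?addr0 // => l lm.
  case: eqP => [e|]; last by rewrite mulr0.
  have em := node_value_inj hm (ltn_ord l : (l <= n)%N) e.
  by case/eqP: lm; apply: val_inj; rewrite /= inordK.
under eq_bigr => l _ do rewrite -scalerAl mulrC.
apply: (@has_jet_sum _ _ _ r (fun l => (t - (node j m)%:A) / (t - (node j l)%:A))
  (fun l => ((node j m == node j l)%:R, (node j m - node j l)^-1))) => l _.
exact: has_jet_pole_unif.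
Qed.

Lemma has_jet_polar_infty z r :
  has_jet None (polar_form z r * t) (\sum_(l < n.+1) r l, \sum_(l < n.+1) r l * z l).
Proof.
rewrite /polar_form mulr_suml; under eq_bigr => l _ do rewrite -scalerAl mulrC.
have -> : \sum_(l < n.+1) r l = \sum_(l < n.+1) r l * 1.
  by apply: eq_bigr => l _; rewrite mulr1.
apply: (@has_jet_sum _ _ _ r (fun l => t / (t - (z l)%:A)) (fun l => (1, z l))) => l _.
exact: has_jet_infty_pole.
Qed.

Lemma has_residue_finite c (s : ratfun K) rho :
  has_residue (Some c) s rho = has_value (Some c) (s * (t - c%:A)) rho.
Proof. by rewrite /has_residue /= divr1. Qed.

Lemma has_residue_infty (s : ratfun K) rho :
  has_residue None s rho = has_value None (- (s * t)) rho.
Proof.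
rewrite /has_residue /= invrN invrK mulrN mulNr expr2 -mulrA mulfK ?ratfun_t_neq0 //.
Qed.

Definition twisted_residue (r : nat -> K) (l : nat) : K := - (sg l * r l).

Definition residue_pair (r : nat -> K) : ratfun K * ratfun K :=
  (polar_form (node ord0) r, polar_form (node ord_max) (twisted_residue r)).

(** At the node [[1,0]], where the gluing constant is [1], the residues are minus the left sum on
    one component and the right sum on the other; the hypothesis makes them opposite. *)
Lemma residue_pair_section (r : nat -> K) : \sum_(l < n.+1) r l = \sum_(l < n.+1) sg l * r l ->
  residue_pair r \in section_pred C h.
Proof.
move=> hr; apply/asboolP => -[j p hp|i].
  apply/twisted_smooth; case: p hp => [c|] hp; last by case: (hp ord_max); rewrite prym_node_infty.
  have hc l : (l <= n)%N -> c != node j l.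
    move=> hl; apply/eqP => e; apply: (hp (inord l)).
    by rewrite prym_nodeE inordK ?ltnS ?hl ?e // leqW.
  rewrite /regular_form /= divr1 /component /=; case: eqVneq hc => [->|ej] hc /=.
    exact: has_jet_regular (has_jet_polar_form _ hc).
  have ej' : j = ord_max by apply/eqP; case: j ej {hp hc} => -[|[|//]] lj.
  by rewrite ej' in hc; exact: has_jet_regular (has_jet_polar_form _ hc).
apply/twisted_node; rewrite prym_glueE !prym_nodeE; case: ifP => hi.
  exists (r i); rewrite !has_residue_finite; split.
    exact: has_jet_value (has_jet_polar_node _ _ hi).
  exact: has_jet_value (has_jet_polar_node _ _ hi).
exists (- \sum_(l < n.+1) r l); rewrite !has_residue_infty; split.
  exact/has_valueN/(has_jet_value (has_jet_polar_infty _ _)).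
rewrite mul1r hr -sumrN; apply: has_valueN.
exact: (has_jet_value (has_jet_polar_infty _ (twisted_residue r))).
Qed.

(** On each component, subtracting the polar form with the same residues leaves a function regular
    at finite points and vanishing at infinity, hence zero by [regular_eq0]. The residues at [[1,0]]
    then give the relation. *)
Lemma section_residues (s : sections C h) : exists2 r : nat -> K,
  \sum_(l < n.+1) r l = \sum_(l < n.+1) sg l * r l & val s = residue_pair r.
Proof.
case: s => s /= /asboolP hs.
have /choice[rho hrho] : forall i, exists rho,
  has_residue (C ord0 i) s.1 rho /\ has_residue (C ord_max i) s.2 (- (h i * rho)).
  by move=> i; apply/twisted_node/(hs (Node C i)).
pose r l := rho (inord l).
have res (j : 'I_2) (f : ratfun K) (r' : nat -> K) v :
    (forall l, (l <= n)%N -> has_residue (Some (node j l)) f (r' l)) ->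
    (forall c, (forall l, (l <= n)%N -> c != node j l) -> regular (Some c) f) ->
    has_residue None f v -> f = polar_form (node j) r'.
  move=> hnode hsmooth; rewrite has_residue_infty => hinf; apply/eqP; rewrite -subr_eq0; apply/eqP.
  apply: (@regular_eq0 _ _ (- v - \sum_(l < n.+1) r' l)) => [c|]; last first.
    rewrite mulrBl; apply: has_valueD; last exact/has_valueN/(has_jet_value (has_jet_polar_infty _ _)).
    by have := has_valueN hinf; rewrite opprK.
  have [[l [hl ->]]|hc] := pselect (exists l, (l <= n)%N /\ c = node j l); last first.
    have {}hc l : (l <= n)%N -> c != node j l by move=> hl; apply/eqP => e; case: hc; exists l.
    apply: regularD; first exact: hsmooth.
    rewrite -scaleN1r; apply/regularZ/(has_jet_regular (has_jet_polar_form _ hc)).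
  have := hnode l hl; rewrite has_residue_finite => h1.
  have := has_valueD h1 (has_valueN (has_jet_value (has_jet_polar_node j r' hl))).
  rewrite /= subrr -mulrBl => /has_value0_div /=.
  by rewrite mulfK ?ratfun_tB_neq0.
have smooth j c : (forall l, (l <= n)%N -> c != node j l) -> regular (Some c) (component j s).
  move=> hc; have hp i : Some c <> C j i.
    rewrite prym_nodeE; case: ifP => // hi -[e].
    by have := hc _ hi; rewrite e eqxx.
  have /twisted_smooth := hs (Smooth hp).
  by rewrite /regular_form /= divr1.
have nodes l : (l <= n)%N -> has_residue (Some (node ord0 l)) s.1 (r l) /\
    has_residue (Some (node ord_max l)) s.2 (twisted_residue r l).
  move=> hl; have := hrho (inord l); rewrite !prym_nodeE prym_glueE.
  by rewrite inordK ?ltnS ?hl // leqW.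
have := hrho ord_max; rewrite !prym_node_infty prym_glueE /= ltnn mul1r => -[inf1 inf2].
have e1 : s.1 = polar_form (node ord0) r.
  by apply: (res _ _ _ _ _ (smooth ord0) inf1) => l /nodes[].
have e2 : s.2 = polar_form (node ord_max) (twisted_residue r).
  by apply: (res _ _ _ _ _ (smooth ord_max) inf2) => l /nodes[].
exists r; last by rewrite [LHS]surjective_pairing e1 e2.
move: inf1 inf2; rewrite !has_residue_infty e1 e2 => inf1 inf2.
have := has_value_uniq inf1 (has_valueN (has_jet_value (has_jet_polar_infty _ _))).
have := has_value_uniq inf2 (has_valueN (has_jet_value (has_jet_polar_infty _ _))).
rewrite /= -[in X in _ = X -> _]sumrN => e2' e1'.
move: e2'; rewrite e1' opprK => ->.
by apply: eq_bigr => l _; rewrite opprK.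
Qed.

End PrymSections.

(** * Functionals on differentials *)

Section LinearFunctionals.
Variable K : fieldType.

Lemma linear_fun_sum (U V : lmodType K) (f : U -> V) m (c : 'I_m -> K) (u : 'I_m -> U) :
  linear f -> f (\sum_q c q *: u q) = \sum_q c q *: f (u q).
Proof.
move=> hf; elim: m c u => [|m IH] c u; first by rewrite !big_ord0 (linear_map0 hf).
by rewrite !big_ord_recl hf IH.
Qed.

Lemma wedge_linear_l (V : lmodType K) (w : V) : linear (fun v => wedge v w).
Proof. by move=> k u v; apply/gen_lincomb/wedge_linl. Qed.

Lemma wedge_linear_r (V : lmodType K) (w : V) : linear (fun v => wedge w v).
Proof. by move=> k u v; apply/gen_lincomb/wedge_linr. Qed.

Lemma wedge_diag (V : lmodType K) (v : V) : wedge v v = 0.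
Proof.
rewrite /wedge /gen -[RHS](linear_map0 (@presented_pi_linear _ _ (@wedge_rel K V))).
apply: presented_eq; rewrite subr0 inE; apply/asboolP.
by rewrite -[<< _ >>]addr0 -[<< _ >>]scale1r; do 2?constructor.
Qed.

Lemma wedge_opp (V : lmodType K) (v w : V) : wedge v w = - wedge w v.
Proof.
have Dl (u u' z : V) : wedge (u + u') z = wedge u z + wedge u' z.
  by have := wedge_linear_l z 1 u u'; rewrite !scale1r.
have Dr (u u' z : V) : wedge z (u + u') = wedge z u + wedge z u'.
  by have := wedge_linear_r z 1 u u'; rewrite !scale1r.
have := wedge_diag (v + w); rewrite Dl !Dr !wedge_diag addr0 add0r.
by move=> /eqP; rewrite addr_eq0 => /eqP.
Qed.

Variable B : comAlgType K.

(** The bilinear maps that factor through the module of differentials. *)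
Definition differential_form (eta : B -> B -> K) : Prop := [/\
  forall k a b c, eta (k *: a + b) c = k * eta a c + eta b c,
  forall k a b c, eta c (k *: a + b) = k * eta c a + eta c b &
  forall b c e, eta b (c * e) = eta (b * c) e + eta (b * e) c].

Lemma kahler_functional eta : differential_form eta ->
  exists2 lambda : kahler B -> K^o, linear lambda & forall b c, lambda (bd b c) = eta b c.
Proof.
move=> [hl hr hL]; pose f (u : B * B) : K^o := eta u.1 u.2.
have hrel u : kahler_rel u -> fglift f u = 0.
  case=> [k {}u v w|k {}u v w|b c e].
  - by rewrite fgliftB fglift_linear !liftU !scale1r /f /= hl subrr.
  - by rewrite fgliftB fglift_linear !liftU !scale1r /f /= hr subrr.
  - by rewrite fgliftB fgliftD !liftU !scale1r /f /= hL subrr.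
exists (presented_lift f); first exact: presented_lift_linear.
by move=> b c; apply: presented_lift_gen.
Qed.
End LinearFunctionals.

Section GaussFunctionals.
Variables (K : fieldType) (g : nat) (C : binary_curve K g) (h : gluing K g).

(** Each functional on the differentials at a point gives one linear equation on the coefficients of
    a kernel element. *)
Lemma gauss_functional x (e : frame h x) (eta : stalk x -> stalk x -> K) m (c : 'I_m -> K)
    (s s' : 'I_m -> sections C h) : differential_form eta ->
  gauss_germ (\sum_q c q *: wedge (s q) (s' q)) e = 0 ->
  \sum_q c q * (eta (coordinate e (s q)) (coordinate e (s' q)) -
                eta (coordinate e (s' q)) (coordinate e (s q))) = 0.
Proof.
move=> /kahler_functional[lambda hlin hbd].
rewrite (linear_fun_sum _ _ (gauss_germ_linear e)) => /(congr1 lambda).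
rewrite (linear_fun_sum _ _ hlin) (linear_map0 hlin) => hsum; rewrite -[RHS]hsum.
apply: eq_bigr => q _; rewrite gauss_germ_wedge /gauss_form; congr (_ * _).
by rewrite -!hbd (additive_linear hlin).
Qed.

Lemma smooth_regular j p hp (f : stalk (@Smooth K g C j p hp)) : regular p (val f).
Proof. exact/asboolP/(valP f). Qed.

(** The functional is the evaluation of $b\,dc$ at [p]. *)
Lemma smooth_differential_form j p hp :
  differential_form (fun b c : stalk (@Smooth K g C j p hp) =>
    (jet p (val b)).1 * (jet p (val c)).2).
Proof.
have hreg := @smooth_regular j p hp; split=> [k a b c|k a b c|b c e].
- have -> : val (k *: a + b) = k *: val a + val b by [].
  by rewrite (jet_lin _ (hreg a) (hreg b)) /=; ring.
- have -> : val (k *: a + b) = k *: val a + val b by [].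
  by rewrite (jet_lin _ (hreg a) (hreg b)) /=; ring.
- have valM (u v : stalk (@Smooth K g C j p hp)) : val (u * v) = val u * val v by [].
  by rewrite !valM !(jetM (hreg _) (hreg _)) /=; ring.
Qed.

Lemma node_regular i (f : stalk (Node C i)) :
  [/\ regular (C ord0 i) (val f).1, regular (C ord_max i) (val f).2 &
    (jet (C ord0 i) (val f).1).1 = (jet (C ord_max i) (val f).2).1].
Proof.
have /asboolP[v [h1 h2]] := valP f.
have r1 : regular (C ord0 i) (val f).1 by exists v.
have r2 : regular (C ord_max i) (val f).2 by exists v.
split=> //.
rewrite (has_value_uniq (has_jet_value (has_jet_jet r1)) h1).
by rewrite (has_value_uniq (has_jet_value (has_jet_jet r2)) h2).
Qed.

(** With local coordinates [x], [y] at the node, this sends the torsion element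
    [x dy = - y dx] to [1]. *)
Definition torsion_form i (b c : stalk (Node C i)) : K :=
  (jet (C ord0 i) (val b).1).2 * (jet (C ord_max i) (val c).2).2 -
  (jet (C ord_max i) (val b).2).2 * (jet (C ord0 i) (val c).1).2.

(** The Leibniz rule uses that a germ takes the same value on both branches; the terms containing
    the value of [b] cancel in pairs. *)
Lemma node_differential_form i : differential_form (@torsion_form i).
Proof.
have r1 f := let: And3 r1 _ _ := @node_regular i f in r1.
have r2 f := let: And3 _ r2 _ := @node_regular i f in r2.
have r12 f := let: And3 _ _ e := @node_regular i f in e.
rewrite /torsion_form; split=> [k a b c|k a b c|b c e].
- have -> : (val (k *: a + b)).1 = k *: (val a).1 + (val b).1 by [].
  have -> : (val (k *: a + b)).2 = k *: (val a).2 + (val b).2 by [].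
  by rewrite (jet_lin _ (r1 a) (r1 b)) (jet_lin _ (r2 a) (r2 b)) /=; ring.
- have -> : (val (k *: a + b)).1 = k *: (val a).1 + (val b).1 by [].
  have -> : (val (k *: a + b)).2 = k *: (val a).2 + (val b).2 by [].
  by rewrite (jet_lin _ (r1 a) (r1 b)) (jet_lin _ (r2 a) (r2 b)) /=; ring.
- have valM1 (u v : stalk (Node C i)) : (val (u * v)).1 = (val u).1 * (val v).1 by [].
  have valM2 (u v : stalk (Node C i)) : (val (u * v)).2 = (val u).2 * (val v).2 by [].
  by rewrite !valM1 !valM2 !(jetM (r1 _) (r1 _)) !(jetM (r2 _) (r2 _)) /= !r12; ring.
Qed.

End GaussFunctionals.

Section Forms.
Variables (R : comNzRingType) (n : nat).

Lemma copole_cons (z : nat -> R) c l e : (l <= n)%N -> l \notin e ->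
  copole n z c e = (c - z l) * copole n z c (l :: e).
Proof.
have copoleE s : copole n z c s = \prod_(q <- iota 0 n.+1 | q \notin s) (c - z q).
  rewrite /copole; elim: (iota 0 n.+1) => [|q r IH]; first by rewrite big_nil.
  by rewrite big_cons /=; case: ifP => _ //=; rewrite IH.
move=> hl le; rewrite !copoleE -big_filter.
have lr : l \in [seq q <- iota 0 n.+1 | q \notin e] by rewrite mem_filter le mem_iota.
rewrite (bigD1_seq _ lr) ?filter_uniq ?iota_uniq //.
by rewrite big_filter_cond; congr (_ * _); apply: eq_bigl => q; rewrite inE negb_or andbC.
Qed.

Lemma at_basis_scale (f f' : nat -> R) k i : (i < n)%N ->
  (forall l, (l <= n)%N -> f l = k * f' l) -> at_basis n f i = k * at_basis n f' i.
Proof.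
move=> hi hf; rewrite /at_basis hf ?(ltnW hi) // mulrBr.
by case: ifP => _; rewrite ?mulr0 // hf.
Qed.

(** This relates the polynomial entries to the actual jets: the factors [k] and [k'] that clear
    denominators do not depend on the residue index. *)
Lemma gauss_entry_scale (x y L L' : nat -> R) b k k' ij :
  (forall l, (l <= n)%N -> left_form n x y b l = k * L l) ->
  (forall l, (l <= n)%N -> right_form n x y b l = k' * L' l) ->
  (ij.1 < n)%N -> (ij.2 < n)%N ->
  gauss_entry n x y b ij = k * k' * (at_basis n L ij.1 * at_basis n L' ij.2 -
                                     at_basis n L ij.2 * at_basis n L' ij.1).
Proof.
move=> hL hL' h1 h2; rewrite /gauss_entry.
rewrite !(at_basis_scale h1 hL) !(at_basis_scale h2 hL).
rewrite !(at_basis_scale h1 hL') !(at_basis_scale h2 hL').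
by ring.
Qed.

Lemma mem_pairs i j : ((i, j) \in pairs n) = (i < j < n)%N.
Proof.
apply/allpairsPdep/idP => [[j' [i' [+ + [-> ->]]]]|/andP[hi hj]].
  by rewrite !mem_iota /= => ? ?; lia.
by exists j, i; rewrite !mem_iota; split=> //; lia.
Qed.

Definition basis_residue (i l : nat) : R :=
  (l == i)%:R - (if (i < n.+1./2)%N then 0 else (l == n)%:R).

Lemma sum_basis_residue (f : nat -> R) i : (i < n)%N ->
  \sum_(l < n.+1) basis_residue i l * f l = at_basis n f i.
Proof.
have sum_delta k : (k <= n)%N -> \sum_(l < n.+1) (l == k :> nat)%:R * f l = f k.
  move=> hk; rewrite (bigD1 (inord k)) //= inordK ?ltnS // eqxx mul1r big1 ?addr0 // => l lk.
  case: eqP => [e|]; last by rewrite mul0r.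
  by case/eqP: lk; apply: val_inj; rewrite /= inordK.
move=> hi; under eq_bigr => l _ do rewrite mulrBl.
rewrite sumrB sum_delta ?(ltnW hi) // /at_basis; congr (_ - _).
case: ifP => _; last exact: sum_delta.
by rewrite big1 // => l _; rewrite mul0r.
Qed.
End Forms.

(** * Generators of the space of sections and of its exterior square *)

Section PrymGauss.
Variables (K : numClosedFieldType) (n : nat) (n_gt0 : (0 < n)%N).
Variables (a : 'M[K]_(n, 2)) (ha : @prym_parameters K n.+1 a).
Local Notation C := (prym_curve ha).
Local Notation h := (prym_gluing K n.+1).
Local Notation t := (ratfun_t K).
Local Notation node j := (node_value a j).
Local Notation sg := (sign n K).
Local Notation res := (basis_residue K n).

Definition basis_section (i : nat) : sections C h := insubd 0 (residue_pair a (res i)).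

Lemma val_basis_section i : (i < n)%N -> val (basis_section i) = residue_pair a (res i).
Proof.
move=> hi; rewrite insubdK //; apply: residue_pair_section => //.
have e1 := sum_basis_residue (fun=> 1 : K) hi.
transitivity (\sum_(l < n.+1) res i l * 1); first by apply: eq_bigr => l _; rewrite mulr1.
rewrite {}e1; transitivity (\sum_(l < n.+1) res i l * sg l); last first.
  by apply: eq_bigr => l _; rewrite mulrC.
rewrite sum_basis_residue // /at_basis /sign.
(* The last finite node always has sign [-1], so for [e_i - e_n] both sides of the residue relation
   vanish. *)
have -> : (n < n.+1./2)%N = false by lia.
by case: ifP => _; rewrite ?subr0 // subrr opprK addNr.
Qed.

(** The relation says that twice the sum of the residues of sign [-1] is zero, so [r n] is minus the
    sum of the others. *)
Lemma residue_basis (r : nat -> K) l : (l <= n)%N ->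
  \sum_(l < n.+1) r l = \sum_(l < n.+1) sg l * r l ->
  r l = \sum_(i < n) r i * res i l.
Proof.
move=> hl hr; have hn : (n < n.+1./2)%N = false by lia.
have tail : \sum_(i < n.+1 | ~~ (i < n.+1./2)%N) r i = 0.
  have : \sum_(l < n.+1) (r l - sg l * r l) = 0 by rewrite sumrB hr subrr.
  rewrite (bigID (fun i : 'I_n.+1 => (i < n.+1./2)%N)) /= big1 => [|i hi]; last first.
    by rewrite /sign hi mul1r subrr.
  rewrite add0r (eq_bigr (fun i : 'I_n.+1 => 2 * r i)) => [|i hi]; last first.
    by rewrite /sign (negbTE hi) mulN1r opprK mulr2n mulrDl mul1r.
  by rewrite -mulr_sumr => /eqP; rewrite mulf_eq0 pnatr_eq0 => /eqP.
move: tail; rewrite big_mkcond big_ord_recr /= hn /= => tail.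
rewrite /basis_residue; under eq_bigr => i _ do rewrite mulrBr.
rewrite sumrB; move: hl; rewrite leq_eqVlt => /orP[/eqP->|hl].
  rewrite big1 => [|i _]; last by rewrite gtn_eqF ?mulr0.
  rewrite sub0r eqxx; move: tail => /eqP; rewrite addrC addr_eq0 => /eqP->.
  congr (- _); apply: eq_bigr => i _; rewrite -[uphalf n]/(n.+1./2).
  by case: (i < n.+1./2)%N; rewrite ?mulr0 ?mulr1.
have -> : \sum_(i < n) r i * (l == i)%:R = r l.
  rewrite (bigD1 (Ordinal hl)) //= eqxx mulr1 big1 ?addr0 // => i hi.
  case: eqP => [e|]; last by rewrite mulr0.
  by case/eqP: hi; apply: val_inj.
rewrite big1 ?subr0 // => i _; rewrite (ltn_eqF hl).
by case: ifP; rewrite mulr0.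
Qed.

Lemma polar_form_sum (z : nat -> K) (r : nat -> K) (c : nat -> K) (F : nat -> nat -> K) :
  (forall l, (l <= n)%N -> r l = \sum_(i < n) c i * F i l) ->
  polar_form n z r = \sum_(i < n) c i *: polar_form n z (F i).
Proof.
move=> hr; rewrite /polar_form; under [RHS]eq_bigr => i _ do rewrite scaler_sumr.
rewrite exchange_big; apply: eq_bigr => l _ /=; rewrite (hr l (ltn_ord l)) scaler_suml.
by apply: eq_bigr => i _; rewrite scalerA.
Qed.

Lemma section_basis (s : sections C h) :
  exists c : 'I_n -> K, s = \sum_i c i *: basis_section i.
Proof.
have [r hr es] := section_residues s; exists (fun i => r i); apply: val_inj.
have val_sum m (c : nat -> K) (u : nat -> sections C h) :
    val (\sum_(i < m) c i *: u i) = (\sum_(i < m) c i *: (val (u i)).1,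
                                     \sum_(i < m) c i *: (val (u i)).2).
  elim: m => [|m IH]; first by rewrite !big_ord0.
  by rewrite !big_ord_recr; apply: etrans (f_equal2 +%R IH (erefl _)) _.
rewrite val_sum es /residue_pair; congr pair.
  under eq_bigr => i _ do rewrite val_basis_section //.
  by apply: polar_form_sum => l hl; apply: residue_basis.
under eq_bigr => i _ do rewrite val_basis_section //.
apply: (@polar_form_sum _ _ r (fun i => twisted_residue n (res i))) => l hl.
rewrite /twisted_residue [in LHS](residue_basis hl hr).
by rewrite mulr_sumr -sumrN; apply: eq_bigr => i _; rewrite mulrN mulrCA.
Qed.

Local Notation pair_at q := (nth (0, 0)%N (pairs n) q).

Lemma wedge_basis (w : wedge2 (sections C h)) : exists c : 'I_(size (pairs n)) -> K,
  w = \sum_q c q *: wedge (basis_section (pair_at q).1) (basis_section (pair_at q).2).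
Proof.
pose F (q : nat) := wedge (basis_section (pair_at q).1) (basis_section (pair_at q).2).
pose spanned w := exists c : 'I_(size (pairs n)) -> K, w = \sum_q c q *: F (q : nat).
rewrite -/(spanned w).
have sp0 : spanned 0.
  by exists (fun=> 0); rewrite big1 // => q _; rewrite scale0r.
have spD k u v : spanned u -> spanned v -> spanned (k *: u + v).
  move=> [c ->] [c' ->]; exists (fun q => k * c q + c' q).
  rewrite scaler_sumr -big_split; apply: eq_bigr => q _.
  by rewrite scalerDl scalerA.
have splt i j : (i < j < n)%N -> spanned (wedge (basis_section i) (basis_section j)).
  rewrite -mem_pairs => hij; pose q0 := Ordinal (etrans (index_mem _ _) hij).
  exists (fun q => (q == q0)%:R); rewrite (bigD1 q0) //= eqxx scale1r big1 ?addr0 => [|q /negbTE->].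
    by rewrite /F nth_index.
  by rewrite scale0r.
have spb i j : (i < n)%N -> (j < n)%N -> spanned (wedge (basis_section i) (basis_section j)).
  move=> hi hj; have [lt|lt|->] := ltngtP i j.
  - by apply: splt; rewrite lt.
  - rewrite wedge_opp -scaleN1r -[_ *: _]addr0; apply: spD => //.
    by apply: splt; rewrite lt.
  - by rewrite wedge_diag.
have spsum (f : sections C h -> wedge2 (sections C h)) m (c : nat -> K) (u : nat -> sections C h) :
    linear f -> (forall i, (i < m)%N -> spanned (f (u i))) ->
    spanned (f (\sum_(i < m) c i *: u i)).
  move=> hf; elim: m => [|m IH] hm; first by rewrite big_ord0 (linear_map0 hf).
  rewrite big_ord_recr /= addrC hf; apply: spD; first exact: hm.
  by apply: IH => i hi; apply/hm/ltnW.
elim/wedge2_ind: w => // k v1 v2 w; apply: spD.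
pose ext (c : 'I_n -> K) (i : nat) := if insub i is Some i' then c i' else 0.
have extE (c : 'I_n -> K) :
    \sum_i c i *: basis_section i = \sum_(i < n) ext c i *: basis_section i.
  by apply: eq_bigr => i _; rewrite /ext valK.
have [c ->] := section_basis v1; have [c' ->] := section_basis v2; rewrite (extE c) (extE c').
apply: (spsum (fun v => wedge v _) n (ext c) basis_section) => [|i hi].
  exact: wedge_linear_l.
apply: (spsum (wedge _) n (ext c') basis_section) => [|j hj]; first exact: wedge_linear_r.
exact: spb.
Qed.

End PrymGauss.

(** * The equation obtained from each functional *)

Section Probes.
Variables (K : numClosedFieldType) (n : nat) (n_gt0 : (0 < n)%N).
Variables (a : 'M[K]_(n, 2)) (ha : @prym_parameters K n.+1 a).
Local Notation C := (prym_curve ha).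
Local Notation h := (prym_gluing K n.+1).
Local Notation t := (ratfun_t K).
Local Notation node j := (node_value a j).
Local Notation sg := (sign n K).
Local Notation res := (basis_residue K n).
Local Notation pair_at q := (nth (0, 0)%N (pairs n) q).
Local Notation entry := (gauss_entry n (node ord0) (node ord_max)).
Local Notation basis := (basis_section ha).

Variable c : 'I_(size (pairs n)) -> K.
Hypothesis gauss0 : forall x (e : frame (C := C) h x),
  gauss_germ (\sum_q c q *: wedge (basis (pair_at q).1) (basis (pair_at q).2)) e = 0.

Lemma pair_at_lt (q : 'I_(size (pairs n))) : ((pair_at q).1 < n)%N /\ ((pair_at q).2 < n)%N.
Proof.
have := mem_nth (0, 0)%N (ltn_ord q); case: (pair_at q) => i j; rewrite mem_pairs /= => ?.
by lia.
Qed.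

Lemma probe_eq0 b x (e : frame (C := C) h x) (eta : stalk x -> stalk x -> K) k :
  differential_form eta ->
  (forall i j, (i < n)%N -> (j < n)%N -> entry b (i, j) =
    k * (eta (coordinate e (basis i)) (coordinate e (basis j)) -
         eta (coordinate e (basis j)) (coordinate e (basis i)))) ->
  \sum_q c q * entry b (pair_at q) = 0.
Proof.
move=> heta hentry; have := gauss_functional heta (gauss0 e) => /(congr1 (fun v => k * v)).
rewrite mulr0 mulr_sumr => {2}<-; apply: eq_bigr => q _.
have [h1 h2] := pair_at_lt q; move: h1 h2; case: (pair_at q) => i j /= hi hj.
by rewrite hentry // mulrCA.
Qed.

Lemma point_probe_eq0 (j : bool) d : \sum_q c q * entry (PointValue j d) (pair_at q) = 0.
Proof.
pose J : 'I_2 := if j then ord_max else ord0; pose z := node J.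
pose s l : K := if j then sg l else 1; pose A := copole n z d%:R [::].
have zE : (if j then node ord_max else node ord0) = z by rewrite /z /J; case: (j).
have [[m [hm em]]|hd] := pselect (exists m, (m <= n)%N /\ d%:R = z m).
  (* Both linear forms vanish outside the residue at the node [m]. *)
  pose B := copole n z d%:R [:: m].
  rewrite big1 // => q _; have [h1 h2] := pair_at_lt q.
  rewrite (@gauss_entry_scale _ _ _ _ (left_form n (node ord0) (node ord_max) (PointValue j d))
    (left_form n (node ord0) (node ord_max) (PointValue j d)) _ 1 B) //;
    first by rewrite [X in _ - X]mulrC subrr !mulr0.
    by move=> l _; rewrite mul1r.
  move=> l hl; rewrite /= zE; have [->|lm] := eqVneq l m; first by rewrite mulrC.
  by rewrite (@copole_cons _ _ _ _ m) ?inE 1?eq_sym // em subrr !(mul0r, mulr0).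
have {}hd l : (l <= n)%N -> d%:R != z l by move=> hl; apply/eqP => el; case: hd; exists l.
have hp i : Some d%:R <> C J i.
  by rewrite prym_nodeE; case: ifP => // hi -[el]; have := hd _ hi; rewrite el eqxx.
have hxi : unit_at (Some d%:R) ((1 : ratfun K) / dunif (Some d%:R)).
  by rewrite divr1; apply: unit_at1.
(* The frame is [dt] with the constant [1], so that coordinates are the components themselves. *)
pose e := Frame (smooth_dualizing_generator hp hxi) (smooth_bundle_generator h hp (unit_at1 _)).
have coordE S : val (coordinate e S) = component J (val S).
  by apply: (mulIr (frame_unit e)); rewrite -coordinateE /= !mulr1.
pose L l := (if j then - sg l else 1) * (d%:R - z l)^-1.
pose L' l := (if j then - sg l else 1) * - (d%:R - z l)^-2.
have jetE i : (i < n)%N ->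
    jet (Some d%:R) (val (coordinate e (basis i))) = (at_basis n L i, at_basis n L' i).
  move=> hi; rewrite coordE val_basis_section //; apply: jetP.
  rewrite -!sum_basis_residue // /residue_pair /component.
  have tw (f : nat -> K) : \sum_(l < n.+1) res i l * ((if j then - sg l else 1) * f l) =
      \sum_(l < n.+1) (if j then twisted_residue n (res i) l else res i l) * f l.
    by apply: eq_bigr => l _; rewrite /twisted_residue; case: (j);
      rewrite ?mul1r // mulrA mulrN [res i l * _]mulrC.
  rewrite (tw (fun l => (d%:R - z l)^-1)) (tw (fun l => - (d%:R - z l)^-2)).
  have -> : (if J == ord0 then polar_form n (node ord0) (res i)
     else polar_form n (node ord_max) (twisted_residue n (res i))) =
     polar_form n z (fun l => if j then twisted_residue n (res i) l else res i l).
    by rewrite /z /J; case: (j).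
  exact: (has_jet_polar_form (fun l => if j then twisted_residue n (res i) l else res i l) hd).
(* [A] clears the denominators of the values and [A ^+ 2] those of the slopes; [eps] absorbs the
   minus sign of the residues on the second component. *)
pose eps : K := if j then -1 else 1.
apply: (@probe_eq0 _ _ e _ (- eps * A * (eps * A ^+ 2))
  (@smooth_differential_form K n.+1 C J (Some d%:R) hp)) => i i' hi hi'.
have cop l : (l <= n)%N -> copole n z d%:R [:: l] = A * (d%:R - z l)^-1.
  by move=> hl; rewrite /A (@copole_cons _ _ z d%:R l [::] hl) // mulrAC mulfV ?mul1r // subr_eq0 hd.
rewrite !jetE // (@gauss_entry_scale _ _ _ _ L L' _ (eps * A) (- eps * A ^+ 2)) //=; first by ring.
  move=> l hl; rewrite zE cop // /L /eps; case: (j); ring.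
move=> l hl; rewrite zE cop // /L' /eps -exprVn; case: (j); ring.
Qed.

(** [torsion_form] is alternating, so antisymmetrising doubles it; hence the division by 2. *)
Lemma torsion_probe_eq0 b i k k' (L L' : nat -> K) (e : frame (C := C) h (Node C i)) :
  (forall l, (l <= n)%N -> left_form n (node ord0) (node ord_max) b l = k * L l) ->
  (forall l, (l <= n)%N -> right_form n (node ord0) (node ord_max) b l = k' * L' l) ->
  (forall m, (m < n)%N ->
    (jet (C ord0 i) (val (coordinate e (basis m))).1).2 = at_basis n L m /\
    (jet (C ord_max i) (val (coordinate e (basis m))).2).2 = at_basis n L' m) ->
  \sum_q c q * entry b (pair_at q) = 0.
Proof.
move=> hL hL' hjet.
apply: (@probe_eq0 _ _ e _ (k * k' / 2) (@node_differential_form _ _ C i)) => m m' hm hm'.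
have [j1 j2] := hjet m hm; have [j1' j2'] := hjet m' hm'.
rewrite (gauss_entry_scale hL hL') //= /torsion_form j1 j2 j1' j2'.
have n2 : (2 : K) != 0 by rewrite pnatr_eq0.
by field.
Qed.

(** In the frame of logarithmic forms, the pole at node [m] contributes a constant and the others a
    slope proportional to $1/(z_m-z_l)$. The convention [0^-1 = 0] accounts for the index
    [l = m]. *)
Lemma node_probe_eq0 m : (m <= n)%N -> \sum_q c q * entry (NodeTorsion m) (pair_at q) = 0.
Proof.
move=> hm; pose i : 'I_n.+2 := inord m.
have im : i = m :> nat by rewrite inordK // ltnS leqW.
have Ci j : C j i = Some (node j m) by rewrite prym_nodeE im hm.
have hi : h i = sg m by rewrite prym_glueE im hm.
pose e := Frame (node_dualizing_generator C i) (node_bundle_generator C h i).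
have frameE : frame_xi e * frame_ell e =
    (log_form (C ord0 i) * 1, - log_form (C ord_max i) * (h i)%:A) by [].
have coordE S : val (coordinate e S) =
    ((val S).1 * (t - (node ord0 m)%:A), - sg m *: ((val S).2 * (t - (node ord_max m)%:A))).
  apply: (mulIr (frame_unit e)); rewrite -coordinateE frameE hi !Ci /log_form /= !mul1r.
  rewrite [LHS]surjective_pairing; congr pair;
    rewrite /= ?mulr1 ?mulfK ?ratfun_tB_neq0 ?divfK ?ratfun_tB_neq0 //.
  rewrite mulr_algr scalerN -scaleNr -scalerAl -scalerAr scalerA mulrNN sign_sq scale1r.
  by rewrite mulfK ?ratfun_tB_neq0.
pose A j := copole n (node j) (node j m) [:: m].
have cop j l : (l <= n)%N -> l != m ->
    copole n (node j) (node j m) [:: l; m] = A j * (node j m - node j l)^-1.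
  move=> hl lm; rewrite /A (@copole_cons _ _ (node j) _ l [:: m] hl) ?inE // mulrAC mulfV ?mul1r //.
  by rewrite subr_eq0; apply: contra lm => /eqP/node_value_inj => ->.
apply: (@torsion_probe_eq0 _ _ (A ord0) (sg m * A ord_max) (fun l => (node ord0 m - node ord0 l)^-1)
  (fun l => sg m * (sg l * (node ord_max m - node ord_max l)^-1)) e) => [l hl|l hl|l hl].
- rewrite /=.
  by have [->|lm] := eqVneq l m; rewrite ?subrr ?invr0 ?mulr0 // cop.
- rewrite /=; have [->|lm] := eqVneq l m; first by rewrite subrr invr0 !mulr0.
  by rewrite cop // mulrACA sign_sq mul1r mulrCA.
rewrite coordE val_basis_section // !Ci /=; split.
  by rewrite (jetP (has_jet_polar_node ha _ _ hm)) /= -sum_basis_residue.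
have := has_jet_lin (- sg m) (has_jet_polar_node ha ord_max (twisted_residue n (res l)) hm) (has_jet0 _).
rewrite addr0 => /jetP -> /=; rewrite addr0 -sum_basis_residue // mulr_sumr.
by apply: eq_bigr => l' _; rewrite /twisted_residue; ring.
Qed.

(** The slope of $t/(t-z)$ in the coordinate $1/t$ is $z$, so the linear forms weight residues by
    the node coordinates. *)
Lemma infty_probe_eq0 : \sum_q c q * entry InftyTorsion (pair_at q) = 0.
Proof.
pose i : 'I_n.+2 := ord_max.
have Ci j : C j i = None by rewrite prym_node_infty.
have hi : h i = 1 by rewrite prym_glueE /= ltnn.
pose e := Frame (node_dualizing_generator C i) (node_bundle_generator C h i).
have frameE : frame_xi e * frame_ell e =
    (log_form (C ord0 i) * 1, - log_form (C ord_max i) * (h i)%:A) by [].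
have t0 := @ratfun_t_neq0 K.
have log_infty : log_form None = - t^-1 :> ratfun K.
  by rewrite /log_form /= invrK mulNr expr2 invfM mulfVK.
have coordE S : val (coordinate e S) = (-1 *: ((val S).1 * t), (val S).2 * t).
  apply: (mulIr (frame_unit e)); rewrite -coordinateE frameE hi !Ci log_infty scale1r.
  rewrite [LHS]surjective_pairing; congr pair; rewrite /= !mulr1 ?opprK ?mulfK //.
  by rewrite scaleN1r mulrNN mulfK.
apply: (@torsion_probe_eq0 _ _ (-1) (-1) (fun l => - node ord0 l)
  (fun l => - (sg l * node ord_max l)) e) => [l hl|l hl|l hl].
- by rewrite mulN1r opprK.
- by rewrite mulN1r opprK.
rewrite coordE val_basis_section // !Ci /=; split.
  have := has_jet_lin (-1) (has_jet_polar_infty n (node ord0) (res l)) (has_jet0 _).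
  rewrite addr0 => /jetP -> /=; rewrite addr0 -sum_basis_residue // mulr_sumr.
  by apply: eq_bigr => l' _; ring.
rewrite (jetP (has_jet_polar_infty _ _ _)) /= -sum_basis_residue //.
by apply: eq_bigr => l' _; rewrite /twisted_residue; ring.
Qed.

End Probes.

(** The coefficient vector of a difference with zero image is annihilated by every row of an
    invertible matrix. *)
Lemma gauss_map_injective (K : numClosedFieldType) n (a : 'M[K]_(n, 2))
    (ha : @prym_parameters K n.+1 a) :
  (0 < n)%N -> \det (parameter_matrix a) != 0 ->
  injective (@gauss_map K n.+1 (prym_curve ha) (prym_gluing K n.+1)).
Proof.
move=> n_gt0 hdet w w' ew; apply/eqP; rewrite -subr_eq0; apply/eqP.
have gauss0 x (e : frame (C := prym_curve ha) (prym_gluing K n.+1) x) : gauss_germ (w - w') e = 0.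
  rewrite (additive_linear (gauss_germ_linear e)).
  have := congr1 (fun s : differentials _ _ => differentials_germ s e) ew.
  by move=> /= ->; rewrite subrr.
have [c ec] := wedge_basis n_gt0 (w - w'); rewrite {}ec in gauss0 *.
suff c0 q : c q = 0 by rewrite big1 // => q _; rewrite c0 scale0r.
have : parameter_matrix a *m (\col_q c q) = 0.
  apply/colP => m; rewrite !mxE -[RHS](_ : \sum_q c q *
    gauss_entry n (node_value a ord0) (node_value a ord_max)
      (nth InftyTorsion (probes n) m) (nth (0, 0)%N (pairs n) q) = 0); last first.
    have : all (fun b => if b is NodeTorsion m then (m <= n)%N else true) (probes n).
      rewrite /probes -cat1s !all_cat all_rev all_map; apply/and3P; split=> //.
      by apply/allP => l; rewrite mem_iota.
    move=> /(all_nthP InftyTorsion) hb.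
    (* Past the end of the list, [nth] returns [InftyTorsion], whose equation holds as well. *)
    have [hm|hm] := ltnP m (size (probes n)); last first.
      by rewrite nth_default // (infty_probe_eq0 n_gt0 gauss0).
    move: (hb m hm); case: (nth _ _ _) => [l hl|_|j d _].
    - exact: (node_probe_eq0 n_gt0 gauss0 hl).
    - exact: (infty_probe_eq0 n_gt0 gauss0).
    - exact: (point_probe_eq0 n_gt0 gauss0).
  by apply: eq_bigr => q' _; rewrite !mxE mulrC.
move=> /(congr1 (mulmx (invmx (parameter_matrix a)))).
rewrite mulKmx ?unitmxE ?unitfE // mulmx0 => /colP/(_ q).
by rewrite !mxE.
Qed.

Theorem theorem5p1 (R : realType) (g : nat) (hg : (3 <= g <= 12)%N) :
  exists U : 'M[R[i]]_(g.-1, 2) -> Prop,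
    zariski_open U /\ (exists a, U a) /\
    forall (a : 'M[R[i]]_(g.-1, 2)) (ha : prym_parameters a), U a ->
      injective (@gauss_map R[i] g (prym_curve ha) (prym_gluing R[i] g)).
Proof.
case: g hg => // n hn; exists (fun a => \det (parameter_matrix a) != 0).
split; first exact: parameter_matrix_open.
split; first by apply: parameter_matrix_generic; lia.
by move=> a ha; apply: gauss_map_injective; lia.
Qed.
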